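(* Let $\alpha$ be a positive measure on $\mathbf{R}$ with infinite support and finite moments of all orders $s_n=\int_{\mathbf{R}} x^n\,d\alpha(x)$, $n\ge 0$. For each $N\ge 0$ let $\lambda_N$ be the smallest eigenvalue of the $(N+1)\times(N+1)$ Hankel matrix $\mathcal{H}_N=(s_{j+k})_{0\le j,k\le N}$. Then the moment problem associated with the moments $(s_n)_{n\ge 0}$ is determinate if and only if $\lim_{N\to\infty}\lambda_N=0$.
   Context: The moment problem is the Hamburger moment problem (on the whole real line). It is called determinate if $\alpha$ is the only positive measure on $\mathbf{R}$ having the moments $(s_n)_{n\ge 0}$, and indeterminate otherwise. Since $\alpha$ has infinite support, each $\mathcal{H}_N$ is a real symmetric positive definite matrix, so $\lambda_N>0$, and $\lambda_N$ is decreasing in $N$ (in the weak sense), so the limit exists. *)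

(* Defs.v *)
From HB Require Import structures.
From mathcomp Require Import all_boot all_order all_algebra.
From mathcomp Require Import all_classical all_reals all_analysis.

Set Implicit Arguments.
Unset Strict Implicit.
Unset Printing Implicit Defensive.

Import Order.TTheory GRing.Theory Num.Theory.
Import numFieldNormedType.Exports.

Local Open Scope classical_set_scope.
Local Open Scope ring_scope.

Definition measure_support (R : realType)
    (mu : {measure set (measurableTypeR R) -> \bar R}) : set R :=
  [set x : R | forall U : set R, open U -> U x -> (0 < mu U)%E].

Definition has_moments (R : realType)
    (mu : {measure set (measurableTypeR R) -> \bar R}) (s : nat -> R) : Prop :=
  forall n : nat,
    mu.-integrable [set: measurableTypeR R]
      (fun x : measurableTypeR R => ((x : R) ^+ n)%:E) /\
    (\int[mu]_x ((x : R) ^+ n)%:E = (s n)%:E)%E.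

(* Values of a measure off the sigma-algebra are irrelevant, so uniqueness is
   equality on measurable sets. *)
Definition determinate (R : realType)
    (mu : {measure set (measurableTypeR R) -> \bar R}) (s : nat -> R) : Prop :=
  has_moments mu s /\
  forall nu : {measure set (measurableTypeR R) -> \bar R}, has_moments nu s ->
    forall A : set (measurableTypeR R), measurable A -> nu A = mu A.

Definition hankel (R : realType) (s : nat -> R) (N : nat) : 'M[R]_N.+1 :=
  \matrix_(j < N.+1, k < N.+1) s (j + k)%N.

(* A matrix has finitely many eigenvalues, and a real symmetric matrix of
   positive size has at least one; for such a matrix the infimum is a minimum. *)
Definition smallest_eigenvalue (R : realType) (n : nat) (A : 'M[R]_n) : R :=
  inf [set a : R | eigenvalue A a].

(* Main.v *)
Require Import Defs.
From HB Require Import structures.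
From mathcomp Require Import all_boot all_order all_algebra.
From mathcomp Require Import all_classical all_reals all_analysis.
From mathcomp Require Import measurable_realfun.
From mathcomp Require Import ring lra.
From mathcomp Require Import complex.
From mathcomp Require separable cyclic cyclotomic.

Set Implicit Arguments.
Unset Strict Implicit.
Unset Printing Implicit Defensive.

Import Order.TTheory GRing.Theory Num.Theory.
Import numFieldNormedType.Exports.
Local Open Scope classical_set_scope.
Local Open Scope ring_scope.

(** Write [L] for the linear functional on polynomials sending ['X^n] to [s n],
    so that [L p] is the integral of [p] against any measure with moments [s].
    By the Rayleigh principle the smallest eigenvalue of the Hankel matrix of
    order [N] is the minimum of [L (p ^+ 2)] over the polynomials [p] of degree
    at most [N] whose coefficients have square sum [1]
    ([cvg_smallest_eigenvalue_hankel]).  Hence these eigenvalues stay away from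
    [0] exactly when there is a gap: a constant [c > 0] with
    [c * sum_sqr_coef p <= L (p ^+ 2)] for all [p].  The theorem says that the
    measure is determinate if and only if there is no gap.

    If there is a gap, evaluation at a point [x0] with [|x0| <= 1/2] is bounded
    for the moment inner product, so for a small [k > 0] the functional
    [L p - k p(x0)] is still nonnegative on squares.  Hamburger's theorem
    ([hamburger]) represents it by a measure, and adding mass [k] at [x0] gives
    a measure with moments [s] and an atom of mass at least [k] at [x0].  Were
    the problem determinate, a single finite measure would have such an atom at
    infinitely many points ([gap_not_determinate]).  Hamburger's theorem itself
    follows from a Hahn-Banach extension of [L] to polynomially dominated
    functions, which is positive because nonnegative polynomials are sums of two
    squares; its values on indicators of half-lines are, after right
    regularization, the distribution function of the measure.

    If there is no gap, some polynomials have coefficients of square sum [1] and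
    arbitrarily small moment norm.  Averaging over roots of unity, they are at
    least [1] in modulus somewhere on the unit circle, and moving their roots to
    the lower half-plane, which leaves the modulus on the real line unchanged,
    makes them large at some [x + i] with [|x| <= 1]
    ([sum_sqr_coef_le_line]).  Let [x] be an accumulation point of these base
    points.  If [p] is a polynomial and [mu], [nu] have moments [s], then
    [p (t) / (t - z)] and [p (z) / (t - z)] differ by a polynomial in [t], so
    they have the same integral against [mu - nu]; the first integral is small
    when the moment norm of [p] is small, so if [p (z)] stays large then the
    Stieltjes transform of [mu - nu] vanishes at [z].  The product of [mu - nu]
    with [1 / (t - z)] then annihilates polynomials as well, and iterating gives
    equal integrals against [mu] and [nu] to all rational functions with poles
    at [x + i] and [x - i].
    The argument is carried out over the reals with the denominators
    [(t - x) ^+ 2 + 1] ([agree_step]).  Such rational functions separate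
    half-lines, so [mu] and [nu] agree ([measure_eq_rational]). *)

(** * Rayleigh quotients of symmetric matrices *)

Definition quadform (R : pzRingType) (n : nat) (A : 'M[R]_n) (v : 'rV[R]_n) : R :=
  (v *m A *m v^T) 0 0.

Lemma quadformE (R : pzRingType) (n : nat) (A : 'M[R]_n) (v : 'rV[R]_n) :
  quadform A v = \sum_i \sum_j v 0 i * A i j * v 0 j.
Proof.
rewrite /quadform mxE exchange_big/=; apply: eq_bigr => j _.
by rewrite mxE mulr_suml; apply: eq_bigr => i _; rewrite mxE.
Qed.

Lemma quadform1 (R : pzRingType) (n : nat) (v : 'rV[R]_n) :
  quadform 1%:M v = \sum_i v 0 i ^+ 2.
Proof. by rewrite /quadform mulmx1 mxE; apply: eq_bigr => i _; rewrite mxE. Qed.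

Lemma quadformB (R : pzRingType) (n : nat) (A B : 'M[R]_n) (v : 'rV[R]_n) :
  quadform (A - B) v = quadform A v - quadform B v.
Proof. by rewrite /quadform mulmxBr mulmxBl [LHS]mxE; congr +%R; rewrite mxE. Qed.

Lemma quadformZ (R : comPzRingType) (n : nat) (A : 'M[R]_n) (c : R) (v : 'rV[R]_n) :
  quadform (c *: A) v = c * quadform A v.
Proof. by rewrite /quadform -scalemxAr -scalemxAl mxE. Qed.

Lemma quadform_scalar (R : comPzRingType) (n : nat) (c : R) (v : 'rV[R]_n) :
  quadform c%:M v = c * quadform 1%:M v.
Proof. by rewrite -quadformZ scale_scalar_mx mulr1. Qed.

Lemma quadform_eigen (R : comPzRingType) (n : nat) (A : 'M[R]_n) (a : R) (v : 'rV[R]_n) :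
  v *m A = a *: v -> quadform A v = a * quadform 1%:M v.
Proof. by move=> vA; rewrite /quadform vA -scalemxAl mxE mulmx1. Qed.

Lemma quadform1_ge0 (R : realDomainType) (n : nat) (v : 'rV[R]_n) :
  0 <= quadform 1%:M v.
Proof. by rewrite quadform1 sumr_ge0// => i _; exact: sqr_ge0. Qed.

Lemma quadform1_gt0 (R : realDomainType) (n : nat) (v : 'rV[R]_n) :
  v != 0 -> 0 < quadform 1%:M v.
Proof.
move=> v0; rewrite lt_def quadform1_ge0 andbT; apply: contra v0.
rewrite quadform1 psumr_eq0; last by move=> i _; exact: sqr_ge0.
move=> /allP h; apply/eqP/rowP => i; rewrite mxE; apply/eqP.
by have := h i (mem_index_enum i); rewrite /= sqrf_eq0.
Qed.

Lemma quadform_bound (R : realFieldType) (n : nat) (A : 'M[R]_n) (v : 'rV[R]_n) :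
  `|quadform A v| <= (\sum_i \sum_j `|A i j|) * quadform 1%:M v.
Proof.
have coord i : `|v 0 i| ^+ 2 <= quadform 1%:M v.
  rewrite real_normK ?num_real// quadform1 (bigD1 i)//= lerDl sumr_ge0// => j _; exact: sqr_ge0.
rewrite quadformE mulr_suml (le_trans (ler_norm_sum _ _ _))// ler_sum// => i _.
rewrite mulr_suml (le_trans (ler_norm_sum _ _ _))// ler_sum// => j _.
rewrite mulrAC normrM mulrC ler_wpM2l// normrM.
have := coord i; have := coord j.
by move: (quadform _ _) (normr_ge0 (v 0 i)) (normr_ge0 (v 0 j)) => q; nra.
Qed.

(** Applying nonnegativity to [v - t *: (v *m invmx B)] and using that
    [v *m invmx B] pairs with [v] through [B] to the squared length of [v]
    bounds the form from below. *)
Lemma quadform_coercive (R : realFieldType) (n : nat) (B : 'M[R]_n) :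
  B^T = B -> (forall v, 0 <= quadform B v) -> B \in unitmx ->
  exists2 e : R, 0 < e & forall v, e * quadform 1%:M v <= quadform B v.
Proof.
move=> Bsym Bge0 Bu.
pose S := \sum_i \sum_j `|(invmx B)^T i j|.
have S0 : 0 <= S by rewrite sumr_ge0// => i _; rewrite sumr_ge0.
have C0 : 0 < S + 1 by rewrite ltr_wpDl.
exists (S + 1)^-1; rewrite ?invr_gt0// => v.
set t := (S + 1)^-1; set w := v *m invmx B.
have wB : w *m B = v by rewrite mulmxKV.
have Bw : B *m w^T = v^T by rewrite -[LHS]trmxK trmx_mul trmxK Bsym wB.
have -> : quadform B v =
    quadform B (v - t *: w) + t * quadform 1%:M v *+ 2 - t ^+ 2 * quadform (invmx B)^T v.
  have -> : quadform (invmx B)^T v = (w *m B *m w^T) 0 0.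
    by rewrite wB /quadform trmx_mul mulmxA.
  have mxB (X Y : 'M[R]_1) : (X - Y) 0 0 = X 0 0 - Y 0 0 by rewrite [LHS]mxE [(- Y) 0 0]mxE.
  have mxZ (c : R) (X : 'M[R]_1) : (c *: X) 0 0 = c * X 0 0 by rewrite mxE.
  have -> : quadform B (v - t *: w) =
      quadform B v - t * (v *m B *m w^T) 0 0
      - t * ((v *m v^T) 0 0 - t * (v *m w^T) 0 0).
    have trw : (v - t *: w)^T = v^T - t *: w^T by apply/matrixP => i j; rewrite !mxE.
    rewrite /quadform trw mulmxBl -scalemxAl wB mulmxBl !mulmxBr.
    by rewrite -!scalemxAl -!scalemxAr !(mxB, mxZ) [t * (_ - _)]mulrBr.
  rewrite -[v *m B *m _]mulmxA Bw wB /quadform mulmx1.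
  by ring.
have h1 := Bge0 (v - t *: w); have h2 := quadform_bound (invmx B)^T v.
have {}h2 : quadform (invmx B)^T v <= (S + 1) * quadform 1%:M v.
  apply: le_trans (ler_norm _) (le_trans h2 _).
  by rewrite ler_wpM2r ?quadform1_ge0// lerDl.
have h3 : t ^+ 2 * quadform (invmx B)^T v <= t * quadform 1%:M v.
  rewrite expr2 -mulrA ler_wpM2l ?invr_ge0 ?(ltW C0)//.
  by rewrite mulrC ler_pdivrMr// mulrC.
by lra.
Qed.

(** The supremum [m] of the constants [c] with [c |v|^2 <= v A v^T] is itself
    such a constant, and [A - m] cannot be invertible, since it would then be
    coercive and [m] could be raised. *)
Lemma smallest_eigenvalueP (R : realType) (n : nat) (A : 'M[R]_n.+1) :
  A^T = A ->
  (forall v, smallest_eigenvalue A * quadform 1%:M v <= quadform A v) /\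
  exists2 v, v != 0 & quadform A v = smallest_eigenvalue A * quadform 1%:M v.
Proof.
move=> Asym; pose S := [set c : R | forall v, c * quadform 1%:M v <= quadform A v].
have S0 : S !=set0.
  exists (- \sum_i \sum_j `|A i j|) => v; rewrite mulNr.
  by have := quadform_bound A v; rewrite ler_norml => /andP[].
have e_gt0 : 0 < quadform 1%:M (delta_mx 0 0 : 'rV[R]_n.+1).
  by apply: quadform1_gt0; apply/rV0Pn; exists 0; rewrite mxE eqxx oner_neq0.
have ubS : has_ubound S.
  exists (quadform A (delta_mx 0 0) / quadform 1%:M (delta_mx 0 0 : 'rV[R]_n.+1)) => c Sc.
  by rewrite ler_pdivlMr.
set m := sup S.
have Sm : S m.
  move=> v; have [->|v0] := eqVneq v 0.
    by rewrite /quadform !mul0mx !mxE mulr0.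
  rewrite -ler_pdivlMr ?quadform1_gt0//; apply: ge_sup => // c Sc.
  by rewrite ler_pdivlMr ?quadform1_gt0.
have mB v : quadform (A - m%:M) v = quadform A v - m * quadform 1%:M v.
  by rewrite quadformB quadform_scalar.
have Bsym : (A - m%:M)^T = A - m%:M by rewrite linearB/= tr_scalar_mx Asym.
have detB : \det (A - m%:M) == 0.
  apply/negPn/negP => detB.
  have [|//|e e0 he] := quadform_coercive Bsym.
  - by move=> v; rewrite mB subr_ge0.
  - by rewrite unitmxE unitfE.
  have : m + e <= m.
    apply: ub_le_sup => // v; have := he v; rewrite mB; lra.
  by rewrite gerDl leNgt e0.
have /det0P[v v0 vB] := detB.
have vA : v *m A = m *: v.
  by move: vB; rewrite mulmxBr mul_mx_scalar => /eqP; rewrite subr_eq0 => /eqP.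
have Am : smallest_eigenvalue A = m.
  apply/eqP; rewrite eq_le; apply/andP; split.
  - apply: ge_inf; last by apply/eigenvalueP; exists v.
    exists m => a /eigenvalueP[w wA w0].
    by have := Sm w; rewrite (quadform_eigen wA) ler_pM2r// quadform1_gt0.
  - apply: lb_le_inf; first by exists m; apply/eigenvalueP; exists v.
    move=> a /eigenvalueP[w wA w0].
    by have := Sm w; rewrite (quadform_eigen wA) ler_pM2r// quadform1_gt0.
rewrite Am; split => //; exists v => //.
exact: quadform_eigen.
Qed.

(** * The moment functional and the Hankel matrices *)

Section MomentFunctional.
Variable R : realType.
Implicit Types (s : nat -> R) (p q : {poly R}).

Definition moment_functional s p : R := \sum_(k < size p) p`_k * s k.

Lemma moment_functional_widen s p n :
  (size p <= n)%N -> moment_functional s p = \sum_(k < n) p`_k * s k.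
Proof.
move=> pn; rewrite /moment_functional (big_ord_widen _ (fun k => p`_k * s k) pn).
rewrite [LHS]big_mkcond/=; apply: eq_bigr => i _.
by case: ltnP => // /leq_sizeP ->//; rewrite mul0r.
Qed.

Lemma moment_functional_is_linear s : linear_for *%R (moment_functional s).
Proof.
move=> a p q; pose n := maxn (size (a *: p + q)) (maxn (size p) (size q)).
rewrite 3?(@moment_functional_widen _ _ n) ?leq_maxl// ?leq_max ?leqnn ?orbT//.
rewrite mulr_sumr -big_split/=; apply: eq_bigr => i _.
by rewrite coefD coefZ mulrDl mulrA.
Qed.

HB.instance Definition _ s := GRing.isLinear.Build R {poly R} R *%R
  (moment_functional s) (moment_functional_is_linear s).

Lemma moment_functionalXn s k : moment_functional s 'X^k = s k.
Proof.
rewrite (@moment_functional_widen _ _ k.+1) ?size_polyXn// (bigD1 ord_max)//=.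
rewrite coefXn eqxx mul1r big1 ?addr0// => i ik.
by rewrite coefXn (_ : (i == k :> nat) = false) ?mul0r//; apply/negbTE.
Qed.

Lemma moment_functionalC s c : moment_functional s c%:P = c * s 0%N.
Proof.
by rewrite -[c%:P]mulr1 mul_polyC linearZ/= -(expr0 'X) moment_functionalXn.
Qed.

Definition sum_sqr_coef p : R := \sum_(i < size p) p`_i ^+ 2.

Lemma sum_sqr_coef_widen p n :
  (size p <= n)%N -> sum_sqr_coef p = \sum_(k < n) p`_k ^+ 2.
Proof.
move=> pn; rewrite /sum_sqr_coef (big_ord_widen _ (fun k => p`_k ^+ 2) pn).
rewrite [LHS]big_mkcond/=; apply: eq_bigr => i _.
by case: ltnP => // /leq_sizeP ->//; rewrite expr0n.
Qed.

Lemma sum_sqr_coef_rVpoly n (v : 'rV[R]_n) :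
  sum_sqr_coef (rVpoly v) = quadform 1%:M v.
Proof.
rewrite quadform1 (@sum_sqr_coef_widen _ n) ?size_poly//.
by apply: eq_bigr => i _; rewrite coef_rVpoly_ord.
Qed.

Lemma quadform_hankel s N (v : 'rV[R]_N.+1) :
  quadform (hankel s N) v = moment_functional s (rVpoly v ^+ 2).
Proof.
have vE : rVpoly v = \sum_i v 0 i *: 'X^i.
  rewrite [LHS]poly_def; apply: eq_bigr => i _.
  by rewrite insubT//= => iN; congr (v 0 _ *: _); exact: val_inj.
rewrite quadformE vE expr2 mulr_suml linear_sum; apply: eq_bigr => i _.
rewrite mulr_sumr linear_sum; apply: eq_bigr => j _ /=.
rewrite -[X in moment_functional _ X]scalerAr -[_ *: 'X^i * _]scalerAl -exprD !linearZ/= moment_functionalXn !mxE.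
by ring.
Qed.

Lemma hankel_sym s N : (hankel s N)^T = hankel s N.
Proof. by apply/matrixP => i j; rewrite !mxE addnC. Qed.

(** By the Rayleigh principle, the smallest eigenvalue of a Hankel matrix is
    the least value of [p |-> L (p ^+ 2)] on the polynomials of bounded degree
    whose coefficients have square sum [1]. *)
Lemma cvg_smallest_eigenvalue_hankel s :
  (forall p, 0 <= moment_functional s (p ^+ 2)) ->
  (smallest_eigenvalue (hankel s N) @[N --> \oo] --> (0 : R)) <->
  ~ exists2 c : R, 0 < c &
    forall p, c * sum_sqr_coef p <= moment_functional s (p ^+ 2).
Proof.
move=> s_ge0.
have lam_ge c N : (forall p, c * sum_sqr_coef p <= moment_functional s (p ^+ 2)) ->
    c <= smallest_eigenvalue (hankel s N).
  move=> hc; have [_ [v v0 hv]] := smallest_eigenvalueP (hankel_sym s N).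
  have := hc (rVpoly v).
  by rewrite sum_sqr_coef_rVpoly -quadform_hankel hv ler_pM2r ?quadform1_gt0.
split=> [lam0 [c c0 hc]|noc].
  have : c <= 0.
    by apply: (cvgr_to_ge lam0); apply: nearW => N; exact: lam_ge.
  by rewrite leNgt c0.
apply/cvgrPdist_le => /= e e0.
have [p hp] : exists p, moment_functional s (p ^+ 2) < e * sum_sqr_coef p.
  apply: contrapT => /forallNP h; apply: noc; exists e => // p.
  by rewrite leNgt; apply/negP/h.
exists (size p) => // N /= pN; rewrite sub0r normrN ger0_norm; last first.
  by apply: lam_ge => q; rewrite mul0r.
have [h _] := smallest_eigenvalueP (hankel_sym s N).
have pK : rVpoly (poly_rV p : 'rV_N.+1) = p by rewrite poly_rV_K// leqW.
have := h (poly_rV p); rewrite -sum_sqr_coef_rVpoly quadform_hankel pK.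
have := sum_sqr_coef_rVpoly (poly_rV p : 'rV_N.+1); rewrite pK => pE.
have p0 := quadform1_ge0 (poly_rV p : 'rV_N.+1); rewrite -pE in p0.
move=> /le_lt_trans/(_ hp); rewrite -subr_gt0 -mulrBl.
have {}p0 : 0 < sum_sqr_coef p.
  rewrite lt_def p0 andbT; apply: contraTneq hp => p0'.
  by rewrite p0' mulr0 -leNgt.
by rewrite pmulr_lgt0// subr_gt0 => /ltW.
Qed.

End MomentFunctional.

(** * Polynomials on the complex plane *)

Section ComplexPolynomials.
Local Open Scope complex_scope.
Variable R : realType.
Implicit Types (z w : R[i]) (p q : {poly R}).

Local Notation cpoly := (map_poly (real_complex R)).

Definition sqmod z : R := complex.Re z ^+ 2 + complex.Im z ^+ 2.

Lemma sqmod_ge0 z : 0 <= sqmod z.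
Proof. by rewrite addr_ge0 ?sqr_ge0. Qed.

Lemma sqmodM z w : sqmod (z * w) = sqmod z * sqmod w.
Proof. by case: z w => [a b] [c d]; rewrite /sqmod/=; ring. Qed.

Lemma sqmod_conj z : sqmod (conjc z) = sqmod z.
Proof. by case: z => a b; rewrite /sqmod/= sqrrN. Qed.

Lemma sqmod_real (t : R) : sqmod t%:C = t ^+ 2.
Proof. by rewrite /sqmod/= expr0n/= addr0. Qed.

Lemma conjcXn z n : conjc (z ^+ n) = conjc z ^+ n.
Proof. exact: (rmorphXn (@conjc R)). Qed.

Lemma horner_cpoly_conj p z : (cpoly p).[conjc z] = conjc (cpoly p).[z].
Proof.
elim/poly_ind: p => [|p c IH]; first by rewrite map_poly0 !horner0 (rmorph0 (@conjc R)).
rewrite rmorphD rmorphM/= map_polyX map_polyC !hornerE IH.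
rewrite (rmorphD (@conjc R)) (rmorphM (@conjc R)); congr +%R.
exact/esym/conjc_real.
Qed.

Lemma sqmodE z : (sqmod z)%:C = z * (conjc z).
Proof. by case: z => a b; apply/eqP; rewrite eq_complex /sqmod/=; apply/andP; split; apply/eqP; ring. Qed.

Lemma complex_prim_root_exists n : (0 < n)%N -> exists w : R[i], n.-primitive_root w.
Proof.
move=> n0; have [r Dr] := closed_field_poly_normal ('X^n - 1 : {poly R[i]}).
have mon : 'X^n - 1 \is @monic R[i] by exact: monicXnsubC.
rewrite (monicP mon) scale1r in Dr.
have r1 : all n.-unity_root r by apply/allP => z; rewrite -root_prod_XsubC -Dr.
have szr : (n < (size r).+1)%N by rewrite -(size_prod_XsubC r id) -Dr size_XnsubC.
have [|w] := hasP (cyclic.has_prim_root n0 r1 _ szr); last by exists w.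
by rewrite -separable.separable_prod_XsubC -Dr cyclotomic.separable_Xn_sub_1 // pnatr_eq0 -lt0n.
Qed.

(** The average of [|p|^2] over the [n]-th roots of unity, with [n] above the
    degree of [p], is the square sum of the coefficients. *)
Lemma sum_sqr_coef_le_unit_circle p :
  exists z, sqmod z = 1 /\ sum_sqr_coef p <= sqmod (cpoly p).[z].
Proof.
have [p0|n0] := posnP (size p).
  exists 1; split; first by rewrite /sqmod/= expr1n expr0n addr0.
  by rewrite /sum_sqr_coef p0 big_ord0 sqmod_ge0.
set n := size p in n0 *; have [w wn] := complex_prim_root_exists n0.
have w1 : sqmod w = 1.
  have := congr1 sqmod (prim_expr_order wn).
  have -> : sqmod (w ^+ n) = sqmod w ^+ n.
    elim: n {wn n0} => [|n IH]; first by rewrite !expr0 /sqmod/= expr1n expr0n addr0.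
    by rewrite !exprS sqmodM IH.
  rewrite {2}/sqmod/= expr1n expr0n addr0 => /eqP.
  by rewrite pexpr_eq1 ?sqmod_ge0// => /eqP.
have wV : w * (conjc w) = 1 by rewrite -sqmodE w1.
have avg : \sum_(j < n) sqmod (cpoly p).[w ^+ j] = n%:R * sum_sqr_coef p.
  apply: (@complexI R); rewrite rmorph_sum/=.
  have hornE z : (cpoly p).[z] = \sum_(k < n) (p`_k)%:C * z ^+ k.
    rewrite (@horner_coef_wide _ n) ?size_map_poly//.
    by apply: eq_bigr => k _; rewrite coef_map.
  transitivity (\sum_(j < n) \sum_(k < n) \sum_(l < n)
      (p`_k * p`_l)%:C * (w ^+ k * (conjc w) ^+ l) ^+ j).
    apply: eq_bigr => j _; rewrite sqmodE -horner_cpoly_conj !hornE mulr_suml.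
    apply: eq_bigr => k _; rewrite mulr_sumr; apply: eq_bigr => l _.
    rewrite rmorphM/= conjcXn exprMn.
    by rewrite -!exprM [(k * j)%N]mulnC [(l * j)%N]mulnC; ring.
  rewrite exchange_big/= rmorphM/= rmorph_nat rmorph_sum/= mulr_sumr.
  apply: eq_bigr => k _; rewrite exchange_big/= (bigD1 k)//= [X in _ + X]big1 ?addr0.
    rewrite -mulr_sumr -exprMn wV expr1n.
    by under eq_bigr do rewrite expr1n; rewrite sumr_const card_ord -expr2 mulrC.
  move=> l lk; rewrite -mulr_sumr; set x := w ^+ k * _.
  have xn : x ^+ n = 1.
    rewrite exprMn -!exprM mulnC exprM (prim_expr_order wn) expr1n mul1r.
    by rewrite mulnC exprM -conjcXn (prim_expr_order wn) conjc1 expr1n.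
  have x1 : x != 1.
    apply: contra lk => /eqP x1.
    have : w ^+ k == w ^+ l.
      have := congr1 (fun y => y * w ^+ l) x1; rewrite mul1r /x -mulrA -exprMn.
      by rewrite [(conjc w) * w]mulrC wV expr1n mulr1 => ->.
    by rewrite (eq_prim_root_expr wn) !modn_small// eq_sym.
  have /eqP := subrX1 x n; rewrite xn subrr eq_sym mulf_eq0 subr_eq0 (negPf x1)/=.
  by move=> /eqP ->; rewrite mulr0.
apply: contrapT => /forallNP none.
have : \sum_(j < n) sqmod (cpoly p).[w ^+ j] < \sum_(j < n) sum_sqr_coef p.
  apply: ltr_sum => [|j _].
    by apply/hasP; exists (Ordinal n0); rewrite ?mem_index_enum.
  rewrite ltNge; apply/negP => h; apply: (none (w ^+ j)); split=> //.
  elim: (j : nat) => [|i IH]; first by rewrite expr0 /sqmod/= expr1n expr0n addr0.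
  by rewrite exprS sqmodM w1 mul1r.
by rewrite avg sumr_const card_ord mulr_natl ltxx.
Qed.

(** Replacing the roots of [q] in the upper half plane by their conjugates keeps
    the modulus on the real line and can only raise it above the line; once all
    roots lie below the line, the modulus increases along upward verticals. *)
Lemma reflect_roots (q : {poly R[i]}) : exists q' : {poly R[i]},
  (forall t : R, sqmod q'.[t%:C] = sqmod q.[t%:C]) /\
  (forall x y : R, 0 <= y -> y <= 1 ->
     sqmod q.[Complex x y] <= sqmod q'.[Complex x 1]).
Proof.
have [r ->] := closed_field_poly_normal q; move: (lead_coef q) => c.
suff [q' [h1 h2]] : exists q' : {poly R[i]},
    (forall t : R, sqmod q'.[t%:C] = sqmod (\prod_(z <- r) ('X - z%:P)).[t%:C]) /\
    (forall x y : R, 0 <= y -> y <= 1 ->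
      sqmod (\prod_(z <- r) ('X - z%:P)).[Complex x y] <= sqmod q'.[Complex x 1]).
  exists (c *: q'); split=> [t|x y y0 y1]; first by rewrite !hornerZ !sqmodM h1.
  by rewrite !hornerZ !sqmodM ler_wpM2l ?sqmod_ge0 ?h2.
elim: r => [|z r [q' [h1 h2]]].
  exists 1; rewrite big_nil; split=> [//|x y _ _].
  by rewrite !hornerE.
exists (('X - (Complex (complex.Re z) (- `|complex.Im z|))%:P) * q').
rewrite big_cons; split=> [t|x y y0 y1]; rewrite !hornerM !sqmodM.
  rewrite h1; congr (_ * _); rewrite !hornerE; case: z => a b.
  by rewrite /sqmod/= !sub0r !sqrrN real_normK ?num_real.
apply: ler_pM; rewrite ?sqmod_ge0 ?h2//.
rewrite !hornerE; case: z => a b; rewrite /sqmod/= lerD2l opprK.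
rewrite -(real_normK (num_real (y - b))) lerXn2r ?nnegrE ?addr_ge0//.
by rewrite (le_trans (ler_normB _ _))// lerD2r ger0_norm.
Qed.

Lemma poly_complexE (q : {poly R[i]}) : q =
  cpoly (map_poly (@complex.Re R) q) + (Complex 0 1)%:P * cpoly (map_poly (@complex.Im R) q).
Proof.
apply/polyP => i; rewrite coefD coefCM !coef_map_id0//.
case: (q`_i) => a b; apply/eqP; rewrite eq_complex/=.
by rewrite !(mul0r, mulr0, mul1r, subr0, add0r, addr0, subrr) !eqxx.
Qed.

Lemma horner_cpoly_real p (t : R) : (cpoly p).[t%:C] = (p.[t])%:C.
Proof. exact: horner_map. Qed.

(** The minimal polynomial of [x + i] over the reals. *)
Definition minpoly_addi (x : R) : {poly R} := ('X - x%:P) ^+ 2 + 1.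

Lemma horner_minpoly_addi (x t : R) : (minpoly_addi x).[t] = (t - x) ^+ 2 + 1.
Proof. by rewrite !hornerE. Qed.

Lemma horner_minpoly_addi_ge1 (x t : R) : 1 <= (minpoly_addi x).[t].
Proof. by rewrite horner_minpoly_addi lerDr sqr_ge0. Qed.

Lemma horner_minpoly_addi_gt0 (x t : R) : 0 < (minpoly_addi x).[t].
Proof. exact: lt_le_trans (horner_minpoly_addi_ge1 x t). Qed.

(** Reduction modulo [minpoly_addi x] is evaluation at [x + i]. *)
Lemma poly_mod_sqr_add1 p (x : R) : exists u v (r : {poly R}),
  p = minpoly_addi x * r + (u%:P + v *: ('X - x%:P)) /\
  (cpoly p).[Complex x 1] = Complex u v.
Proof.
set D := minpoly_addi x.
have szD : size D = 3.
  by rewrite /D /minpoly_addi size_polyDl ?size_exp_XsubC ?size_poly1.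
have D0 : D != 0 by rewrite -size_poly_eq0 szD.
have sm : (size (modp p D) <= 2)%N by have := ltn_modp p D; rewrite D0 szD ltnS.
pose c0 := (modp p D)`_0; pose c1 := (modp p D)`_1.
have mE : modp p D = (c0 + c1 * x)%:P + c1 *: ('X - x%:P).
  apply/polyP => i; rewrite coefD coefC coefZ coefB coefX coefC.
  case: i => [|[|i]] /=; rewrite ?subr0 ?mulr1 ?add0r ?sub0r ?mulrN ?addrK ?mulr0 ?addr0//.
  by move/leq_sizeP: sm => ->.
exists (c0 + c1 * x), c1, (divp p D); split.
  by rewrite {1}(divp_eq p D) mE mulrC.
rewrite {1}(divp_eq p D) mE rmorphD/= rmorphM/= hornerD hornerM.
have -> : (cpoly D).[Complex x 1] = 0.
  rewrite /D /minpoly_addi rmorphD rmorphXn/= rmorphB/= map_polyX map_polyC rmorph1 !hornerE.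
  have -> : Complex x 1 - x%:C = Complex 0 1 :> R[i] by apply/eqP; rewrite eq_complex/= subrr subr0 !eqxx.
  by rewrite -[Complex 0 1 ^+ 2]/(Complex 0 1 * Complex 0 1) -expr2 sqr_i addNr.
rewrite mulr0 add0r rmorphD/= map_polyC map_polyZ rmorphB/= map_polyX map_polyC/= !hornerE.
by apply/eqP; rewrite eq_complex/=; apply/andP; split; apply/eqP; ring.
Qed.

(** The polynomial [e] stems from a root reflection of [p]; it sees, at some
    [x + i] with [|x| <= 1], a fixed fraction of the coefficients of [p]. *)
Lemma sum_sqr_coef_le_line p : exists (x u v : R) (e r : {poly R}),
  [/\ `|x| <= 1, forall t, e.[t] ^+ 2 <= p.[t] ^+ 2,
      e = minpoly_addi x * r + (u%:P + v *: ('X - x%:P)) &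
      sum_sqr_coef p <= 4 * (u ^+ 2 + v ^+ 2)].
Proof.
have [[x y] [z1 hz]] := sum_sqr_coef_le_unit_circle p.
have {hz} [y' y'0 [y'1 hz]] : exists2 y', 0 <= y' & y' <= 1 /\
    sum_sqr_coef p <= sqmod (cpoly p).[Complex x y'].
  have : `|y| <= 1.
    rewrite -(@expr_le1 _ 2)// real_normK ?num_real// -z1 /sqmod/= lerDr sqr_ge0//.
  have [y0|y0] := leP 0 y => y1; first by exists y; rewrite // ger0_norm in y1.
  exists (- y); first by rewrite oppr_ge0 ltW.
  rewrite ltr0_norm// in y1; split=> //.
  by rewrite -[Complex x (- y)]/(conjc (Complex x y)) horner_cpoly_conj sqmod_conj.
have x1 : `|x| <= 1.
  by rewrite -(@expr_le1 _ 2)// real_normK ?num_real// -z1 /sqmod/= lerDl sqr_ge0.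
have [q [qR qU]] := reflect_roots (cpoly p).
have {hz y'0} hz := le_trans hz (qU x y' y'0 y'1).
pose A := map_poly (@complex.Re R) q; pose B := map_poly (@complex.Im R) q.
have qE : q = cpoly A + (Complex 0 1)%:P * cpoly B := poly_complexE q.
have AB t : A.[t] ^+ 2 + B.[t] ^+ 2 = p.[t] ^+ 2.
  have := qR t; rewrite qE hornerD hornerM hornerC !horner_cpoly_real sqmod_real => <-.
  by rewrite /sqmod/=; ring.
have {hz} : sum_sqr_coef p <= 4 * sqmod (cpoly A).[Complex x 1] \/
    sum_sqr_coef p <= 4 * sqmod (cpoly B).[Complex x 1].
  move: hz; rewrite qE hornerD hornerM hornerC.
  case: (cpoly A).[_] => a b; case: (cpoly B).[_] => c d.
  rewrite /sqmod/= => hz.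
  have [h|h] := leP (c ^+ 2 + d ^+ 2) (a ^+ 2 + b ^+ 2); [left|right].
  - by apply: le_trans hz _; have := sqr_ge0 (a + d); have := sqr_ge0 (b - c); nra.
  - by apply: le_trans hz _; have := sqr_ge0 (a + d); have := sqr_ge0 (b - c); nra.
case=> hz.
- have [u [v [r [rE vE]]]] := poly_mod_sqr_add1 A x.
  exists x, u, v, A, r; split=> // [t|]; last by move: hz; rewrite vE.
  by rewrite -AB lerDl sqr_ge0.
- have [u [v [r [rE vE]]]] := poly_mod_sqr_add1 B x.
  exists x, u, v, B, r; split=> // [t|]; last by move: hz; rewrite vE.
  by rewrite -AB lerDr sqr_ge0.
Qed.

End ComplexPolynomials.

(** * Measures with given moments *)

Section Moments.
Variable R : realType.
Local Notation RM := (measurableTypeR R).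
Implicit Types (s : nat -> R) (p q : {poly R}) (mu nu : {measure set RM -> \bar R}).

Lemma measurable_horner p : measurable_fun [set: RM] (horner p : RM -> R).
Proof. apply: continuous_measurable_fun; exact: continuous_horner. Qed.

Lemma integrable_ext mu (f g : RM -> R) : (forall x, f x = g x) ->
  mu.-integrable setT (EFin \o f) -> mu.-integrable setT (EFin \o g).
Proof. by move=> /funext ->. Qed.

Lemma moments_poly mu s p : has_moments mu s ->
  mu.-integrable setT (EFin \o (horner p : RM -> R)) /\
  \int[mu]_x p.[x] = moment_functional s p.
Proof.
move=> mus.
have h n (F : 'I_n -> R) : mu.-integrable setT (EFin \o (fun x : RM => \sum_(k < n) F k * x ^+ k)) /\
   \int[mu]_x (\sum_(k < n) F k * x ^+ k) = \sum_(k < n) F k * s k.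
  elim: n F => [|n IH] F.
    under eq_fun do rewrite big_ord0.
    rewrite big_ord0 /Rintegral integral0; split=> //.
    exact: integrable0.
  have [i1 e1] := IH (fun k => F (widen_ord (leqnSn n) k)).
  have [i2 e2] := mus n.
  have i3 : mu.-integrable setT (EFin \o (fun x : RM => F ord_max * x ^+ n)).
    have := integrableZl measurableT (F ord_max) i2.
    by congr (_.-integrable _ _); apply/funext => x /=; rewrite EFinM.
  split.
    apply: (@integrable_ext _ (fun x => \sum_(k < n) F (widen_ord (leqnSn n) k) * x ^+ k +
      F ord_max * x ^+ n)) => [x|]; first by rewrite big_ord_recr.
    have := integrableD measurableT i1 i3.
    by congr (_.-integrable _ _); apply/funext => x /=; rewrite EFinD.
  under [LHS]eq_Rintegral do rewrite big_ord_recr/=.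
  rewrite RintegralD// e1 big_ord_recr/=; congr +%R.
  by rewrite RintegralZl// /Rintegral e2.
have [h1 h2] := h _ (fun k : 'I_(size p) => p`_k).
rewrite /moment_functional -h2; split; last by apply: eq_Rintegral => x _; rewrite horner_coef.
by apply: integrable_ext h1 => x; rewrite horner_coef.
Qed.

Lemma moments_cst_integrable mu s (c : R) : has_moments mu s ->
  mu.-integrable setT (EFin \o cst c : RM -> \bar R).
Proof.
move=> mus; have [h _] := moments_poly c%:P mus.
by apply: integrable_ext h => x; rewrite hornerC.
Qed.

Lemma moments_bounded_integrable mu s (f : RM -> R) (C : R) : has_moments mu s ->
  measurable_fun setT f -> (forall x, `|f x| <= C) ->
  mu.-integrable setT (EFin \o f).
Proof.
move=> mus mf fC; apply: (le_integrable _ _ _ (moments_cst_integrable C mus)) => //.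
  exact/measurable_EFinP.
by move=> x _; rewrite /= lee_fin (le_trans (fC x))// ler_norm.
Qed.

(** The two integrals may be compared on functions that approximate an indicator
    only pointwise and boundedly. *)
Lemma Rintegral_agree_lim mu nu s (f_ : nat -> RM -> R) (f : RM -> R) (C : R) :
  has_moments mu s -> has_moments nu s ->
  (forall n, measurable_fun setT (f_ n)) -> (forall n x, `|f_ n x| <= C) ->
  (forall x, f_ n x @[n --> \oo] --> f x) ->
  (forall n, \int[mu]_x f_ n x = \int[nu]_x f_ n x) ->
  \int[mu]_x f x = \int[nu]_x f x.
Proof.
move=> mus nus mf_ f_C f_f agree.
have mf : measurable_fun setT f.
  by apply: (measurable_fun_cvg (h := f_)) => // x _; exact: f_f.
have dct (m : {measure set RM -> \bar R}) : has_moments m s ->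
    (\int[m]_x (f_ n x)%:E)%E @[n --> \oo] --> (\int[m]_x (f x)%:E)%E.
  move=> ms; have [] := @dominated_convergence _ RM R m setT measurableT
    (fun n => EFin \o f_ n) (EFin \o f) (EFin \o cst C) => //.
  - by move=> n; exact/measurable_EFinP.
  - exact/measurable_EFinP.
  - by apply: aeW => x _; apply: cvg_EFin; [exact: nearW|exact: f_f].
  - exact: moments_cst_integrable ms.
  - by apply: aeW => x n _ /=; rewrite lee_fin.
have e n : (\int[mu]_x (f_ n x)%:E = \int[nu]_x (f_ n x)%:E)%E.
  have fin (m : {measure set RM -> \bar R}) : has_moments m s ->
      (\int[m]_x (f_ n x)%:E)%E \is a fin_num.
    by move=> ms; apply: integrable_fin_num => //; exact: moments_bounded_integrable ms _ (f_C n).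
  rewrite -[LHS]fineK ?fin// -[RHS]fineK ?fin//; congr EFin; exact: agree.
congr fine; have := dct _ nus; under eq_fun do rewrite -e.
by move=> h; apply: cvg_unique (dct _ mus) h.
Qed.

End Moments.

(** * Separating measures by rational functions *)

Section RationalSeparation.
Variable R : realType.
Local Notation RM := (measurableTypeR R).
Implicit Types (p q : {poly R}) (mu nu : {measure set RM -> \bar R}).

(** The iteration from the proof of the Stone-Weierstrass theorem, increasing to
    the absolute value on the interval from [-1] to [1]. *)
Fixpoint abs_approx n : {poly R} :=
  if n is m.+1 then abs_approx m + 2^-1 *: ('X ^+ 2 - abs_approx m ^+ 2) else 0.

Lemma abs_approx_bounds n (y : R) : `|y| <= 1 ->
  0 <= (abs_approx n).[y] /\
  0 <= `|y| - (abs_approx n).[y] <= `|y| * (1 - `|y| / 2) ^+ n.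
Proof.
move=> y1; have y0 := normr_ge0 y; elim: n => [|n [IH0 /andP[IH1 IH2]]].
  by rewrite /= horner0 subr0 expr0 mulr1 lexx y0.
rewrite /= hornerD hornerZ !hornerE -(real_normK (num_real y)) [in _ ^+ n.+1]exprS.
set a := `|y| in y1 y0 IH1 IH2 *; set b := (abs_approx n).[y] in IH0 IH1 IH2 *.
have -> : b + 2^-1 * (a ^+ 2 - b ^+ 2) = a - (a - b) * (1 - (a + b) / 2) by field.
have h1 : 0 <= 1 - (a + b) / 2 by lra.
have h2 : 1 - (a + b) / 2 <= 1 - a / 2 by lra.
split; first by nra.
rewrite subKr mulr_ge0//=.
rewrite [_ * (_ * _)]mulrCA [X in _ <= X]mulrC ler_pM//.
Qed.

Lemma cvg_abs_approx (y : R) : `|y| <= 1 -> (abs_approx n).[y] @[n --> \oo] --> `|y|.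
Proof.
move=> y1; have [->|y0] := eqVneq y 0.
  under eq_fun => n.
    have [h0 /andP[h1 _]] := @abs_approx_bounds n 0 ltac:(by rewrite normr0 ler01).
    have -> : (abs_approx n).[0] = 0.
      by apply/eqP; rewrite eq_le h0 andbT; rewrite normr0 sub0r oppr_ge0 in h1.
    over.
  by rewrite normr0; exact: cvg_cst.
have y0' : 0 < `|y| by rewrite normr_gt0.
have geo : `|y| * (1 - `|y| / 2) ^+ n @[n --> \oo] --> 0.
  rewrite -[X in _ --> X](mulr0 `|y|); apply: cvgM; first exact: cvg_cst.
  by apply: cvg_expr; rewrite ltr_norml; lra.
have sub : `|y| - (abs_approx n).[y] @[n --> \oo] --> 0.
  apply: (squeeze_cvgr _ (cvg_cst 0) geo).
  by apply: nearW => n; have [] := abs_approx_bounds n y1.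
have -> : (fun n => (abs_approx n).[y]) = (fun n => `|y| - (`|y| - (abs_approx n).[y])).
  by apply/funext => n; rewrite subKr.
rewrite -[X in _ --> X]subr0; apply: cvgB => //; exact: cvg_cst.
Qed.

(** Homogenization: a polynomial in [u / d] is a fraction over a power of [d]. *)
Lemma horner_div_homogenize (P u d : {poly R}) : exists q n, forall t,
  d.[t] != 0 -> P.[u.[t] / d.[t]] = q.[t] / d.[t] ^+ n.
Proof.
exists (\sum_(k < size P) P`_k *: (u ^+ k * d ^+ (size P - k))), (size P) => t dt.
rewrite horner_coef horner_sum mulr_suml; apply: eq_bigr => k _.
rewrite hornerZ hornerM !horner_exp -!mulrA expr_div_n; congr (_ * (_ * _)).
have kP : (k <= size P)%N by exact/ltnW/ltn_ord.
by rewrite -[in d.[t] ^- size P](subnK kP) exprD invfM mulrA divff ?mul1r// expf_neq0.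
Qed.

(** The bounded function [g] below has the sign of [t - a], and a polynomial in
    it is one of the given fractions.  Polynomials [P] approximating the
    absolute value carry the agreement over to the positive part of [g], whose
    complements to [1] have powers tending to the indicator of [t <= a]. *)
Lemma measure_eq_rational mu nu s (x : R) : has_moments mu s -> has_moments nu s ->
  (forall q n, \int[mu]_t (q.[t] / (minpoly_addi x).[t] ^+ n) =
               \int[nu]_t (q.[t] / (minpoly_addi x).[t] ^+ n)) ->
  forall A : set RM, measurable A -> mu A = nu A.
Proof.
move=> mus nus agree.
have fin (m : {measure set RM -> \bar R}) (A : set RM) : has_moments m s -> measurable A ->
    (m A < +oo)%E.
  move=> ms mA; apply: (@le_lt_trans _ _ (m setT)).
    by apply: le_measure; rewrite ?inE.
  have [/integrableP[_]] := ms 0%N.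
  by under eq_integral do rewrite expr0 abse1; rewrite integral_cst// mul1e.
refine (@measure_unique _ R RM (@RGenOInfty.G R) (fun n => `](- n%:R), +oo[%classic)
  _ _ _ _ mu nu _ _).
- exact: RGenOInfty.measurableE.
- move=> _ _ [a ->] [b ->]; exists (Num.max a b).
  apply/seteqP; split=> y /=; rewrite !in_itv/= !andbT gt_max.
    by move=> [-> ->].
  by move=> /andP[].
- by move=> n; exists (- n%:R).
- apply/seteqP; split=> // y _; have [n hn] : exists n : nat, `|y| < n%:R.
    by exists (Num.truncn `|y|).+1; rewrite truncnS_gt.
  by exists n => //=; rewrite in_itv/= andbT; move: hn; rewrite ltr_norml => /andP[].
- move=> _ [a ->].
  pose K : R := 1 + `|x - a|; have K0 : 0 < K by rewrite ltr_wpDr.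
  pose u : {poly R} := K^-1 *: ('X - a%:P).
  pose g (t : RM) : R := u.[t] / (minpoly_addi x).[t].
  have D0 t := horner_minpoly_addi_gt0 x t.
  have gE t : g t = (t - a) / (K * (minpoly_addi x).[t]).
    by rewrite /g hornerZ !hornerE invfM; ring.
  have g1 t : `|g t| <= 1.
    rewrite gE normrM normfV [in `|K * _|]gtr0_norm ?mulr_gt0// ler_pdivrMr ?mulr_gt0// mul1r.
    rewrite horner_minpoly_addi /K.
    have -> : t - a = (t - x) + (x - a) by rewrite addrA subrK.
    apply: le_trans (ler_normD _ _) _; rewrite -(real_normK (num_real (t - x))).
    move: (normr_ge0 (t - x)) (normr_ge0 (x - a)); move: `|t - x| `|x - a| => b c b0 c0.
    by have := mulr_ge0 c0 (sqr_ge0 b); have := sqr_ge0 (b - 1); lra.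
  have mg : measurable_fun setT g.
    apply: measurable_funM; first exact: measurable_horner.
    apply: continuous_measurable_fun => t; apply: cvgV; last exact: continuous_horner.
    by rewrite gt_eqF.
  have gP P : \int[mu]_t P.[g t] = \int[nu]_t P.[g t].
    have [q [n hq]] := horner_div_homogenize P u (minpoly_addi x).
    by rewrite (_ : (fun t => P.[g t]) = fun t => q.[t] / (minpoly_addi x).[t] ^+ n)//;
      apply/funext => t; apply: hq; rewrite gt_eqF.
  have gplus t : 0 <= (g t + `|g t|) / 2 <= 1.
    have := g1 t; have := ler_norm (g t); have := ler_norm (- g t); rewrite normrN => *.
    by apply/andP; split; lra.
  have step n : \int[mu]_t (1 - (1 - (g t + `|g t|) / 2) ^+ n) =
                \int[nu]_t (1 - (1 - (g t + `|g t|) / 2) ^+ n).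
    pose P k : {poly R} := 1 - (1 - 2^-1 *: ('X + abs_approx k)) ^+ n.
    have PE k t : (P k).[g t] = 1 - (1 - (g t + (abs_approx k).[g t]) / 2) ^+ n.
      by rewrite /P !(hornerE, horner_exp) mulrC.
    apply: (@Rintegral_agree_lim _ mu nu s (fun k t => (P k).[g t]) _ (1 + 2 ^+ n)) => //.
    + by move=> k; apply: measurableT_comp (measurable_horner _) mg.
    + move=> k t; rewrite PE (le_trans (ler_normB _ _))// normr1 lerD2l normrX.
      rewrite lerXn2r ?nnegrE//; have [h0 /andP[h1 _]] := abs_approx_bounds k (g1 t).
      have := g1 t; have := ler_norm (g t); have := ler_norm (- g t); rewrite normrN => *.
      by rewrite ler_norml; apply/andP; split; lra.
    + move=> t; under eq_fun do rewrite PE.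
      apply: cvgB; first exact: cvg_cst.
      have cexp (v : nat -> R) (l : R) m : v k @[k --> \oo] --> l -> v k ^+ m @[k --> \oo] --> l ^+ m.
        move=> vl; elim: m => [|m IH].
          by under eq_fun do rewrite expr0; rewrite expr0; exact: cvg_cst.
        by under eq_fun do rewrite exprS; rewrite exprS; exact: cvgM.
      apply: cexp; apply: cvgB; first exact: cvg_cst.
      apply: cvgMl; apply: cvgD; first exact: cvg_cst.
      exact: cvg_abs_approx.
  have lim : \int[mu]_t \1_`]a, +oo[%classic t = \int[nu]_t \1_`]a, +oo[%classic t :> R.
    apply: (@Rintegral_agree_lim _ mu nu s
      (fun n t => 1 - (1 - (g t + `|g t|) / 2) ^+ n) _ 1) => //.
    + move=> n; apply: measurable_funB => //; apply: measurable_funX.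
      apply: measurable_funB => //; apply: measurable_funM => //.
      by apply: measurable_funD => //; exact: measurableT_comp.
    + move=> n t; have /andP[h0 h1] := gplus t.
      rewrite ger0_norm ?subr_ge0 ?exprn_ile1 ?subr_ge0 ?gerDl ?oppr_le0//.
      by rewrite exprn_ge0// subr_ge0.
    + move=> t; have [ta|ta] := leP t a.
      * rewrite indicE memNset; last by rewrite /= in_itv/= andbT; apply/negP; rewrite -leNgt.
        have -> : g t + `|g t| = 0.
          rewrite ler0_norm ?subrr// gE pmulr_lle0 ?subr_le0// invr_gt0 mulr_gt0//.
        by under eq_fun do rewrite mul0r subr0 expr1n subrr; exact: cvg_cst.
      * rewrite indicE mem_set; last by rewrite /= in_itv/= andbT.
        have g0 : 0 < g t by rewrite gE divr_gt0 ?subr_gt0 ?mulr_gt0.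
        rewrite -[X in _ --> X]subr0; apply: cvgB; first exact: cvg_cst.
        apply: cvg_expr; have := gplus t; rewrite gtr0_norm// => h.
        by rewrite ltr_norml; lra.
  have ind (m : {measure set RM -> \bar R}) : has_moments m s ->
      (\int[m]_t \1_`]a, +oo[%classic t)%:E = m `]a, +oo[%classic.
    move=> ms; rewrite /Rintegral integral_indic// setIT fineK// ge0_fin_numE//.
    exact: fin.
  by rewrite -(ind mu)// lim ind.
- by move=> n; exact: fin.
Qed.

End RationalSeparation.

(** * Small eigenvalues force determinacy *)

Section Determinacy.
Variable R : realType.
Local Notation RM := (measurableTypeR R).
Implicit Types (s : nat -> R) (p q : {poly R}) (mu nu : {measure set RM -> \bar R}).

Lemma moment_functional_le mu s p q : has_moments mu s ->
  (forall t, p.[t] <= q.[t]) -> moment_functional s p <= moment_functional s q.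
Proof.
move=> mus pq; have [ip <-] := moments_poly p mus; have [iq <-] := moments_poly q mus.
exact: le_Rintegral.
Qed.

Lemma moment_functional_sqr_ge0 mu s p : has_moments mu s ->
  0 <= moment_functional s (p ^+ 2).
Proof.
move=> mus; rewrite -(linear0 (moment_functional s)).
by apply: (moment_functional_le mus) => t; rewrite horner0 horner_exp sqr_ge0.
Qed.

Lemma frac_integrable mu s q x n : has_moments mu s ->
  mu.-integrable setT (EFin \o (fun t : RM => q.[t] / (minpoly_addi x).[t] ^+ n)).
Proof.
move=> mus; have [iq _] := moments_poly q mus.
apply: (le_integrable measurableT _ _ iq).
  apply/measurable_EFinP/measurable_funM; first exact: measurable_horner.
  under eq_fun do rewrite -horner_exp.
  apply: continuous_measurable_fun => t; apply: cvgV; last exact: continuous_horner.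
  by rewrite horner_exp expf_neq0// gt_eqF// horner_minpoly_addi_gt0.
move=> t _; rewrite /= lee_fin normrM ler_piMr// normfV invf_le1.
  by rewrite normrX exprn_ege1// ger0_norm ?horner_minpoly_addi_ge1// ltW// horner_minpoly_addi_gt0.
by rewrite normr_gt0 expf_neq0// gt_eqF// horner_minpoly_addi_gt0.
Qed.

Lemma normr_Rintegral_le mu s (f : RM -> R) p : has_moments mu s ->
  mu.-integrable setT (EFin \o f) -> (forall t, `|f t| <= p.[t]) ->
  `|\int[mu]_t f t| <= moment_functional s p.
Proof.
move=> mus fi fp; have [ip <-] := moments_poly p mus.
apply: le_trans (le_normr_Rintegral measurableT fi) _.
apply: le_Rintegral => //.
  by have := integrable_norm fi; congr (_.-integrable _ _); apply/funext.
Qed.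

(** The residue [u + v i] is the value of [e] at [y + i], so that evaluation at
    this point has norm at least [1 / sqrt d] for the moment inner product. *)
Definition small_at s (d y : R) := exists (u v : R) (e r : {poly R}),
  [/\ u ^+ 2 + v ^+ 2 = 1,
      e = minpoly_addi y * r + (u%:P + v *: ('X - y%:P)) &
      moment_functional s (e ^+ 2) < d].

(** Polynomials whose coefficients are large compared with their moment norm are
    turned into polynomials that are large at height one above the segment from
    [-1] to [1]; by compactness the base points accumulate. *)
Lemma small_at_accumulation mu s : has_moments mu s ->
  (forall c, 0 < c -> exists p, moment_functional s (p ^+ 2) < c * sum_sqr_coef p) ->
  exists x : R, forall d, 0 < d -> exists2 y, `|y - x| < d & small_at s d y.
Proof.
move=> mus small.
have h d : 0 < d -> exists2 y, `|y| <= 1 & small_at s d y.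
  move=> d0; have [p hp] := small (d / 4) (divr_gt0 d0 (ltr0Sn _ 3)).
  (* the factor 4 is lost in passing from [p] to [e] *)
  have [x [u [v [e [r [x1 ep eE hc]]]]]] := sum_sqr_coef_le_line p.
  have p0 : 0 < sum_sqr_coef p.
    have := le_lt_trans (moment_functional_sqr_ge0 p mus) hp.
    by rewrite pmulr_rgt0// divr_gt0.
  set w := u ^+ 2 + v ^+ 2 in hc; have w0 : 0 < w by lra.
  pose c := (Num.sqrt w)^-1; have c2 : c ^+ 2 = w^-1 by rewrite exprVn sqr_sqrtr// ltW.
  exists x => //; exists (c * u), (c * v), (c *: e), (c *: r); split.
  - by rewrite !exprMn -mulrDr c2 mulVf// gt_eqF.
  - by rewrite eE -!mul_polyC !polyCM; ring.
  - rewrite exprZn linearZ/= c2 mulrC ltr_pdivrMr//.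
    apply: (@le_lt_trans _ _ (moment_functional s (p ^+ 2))).
      by apply: (moment_functional_le mus) => t; rewrite !horner_exp.
    by apply: lt_le_trans hp _; rewrite -mulrA ler_pM2l//; lra.
have /choice[y_ hy] n : exists y, `|y| <= 1 /\ small_at s n.+1%:R^-1 y.
  by have [|y y1 hy] := h n.+1%:R^-1; [rewrite invr_gt0|exists y].
have bnd : bounded_fun y_.
  exists 1; split=> // M M1 n _ /=; apply: le_trans (ltW M1); exact: (hy n).1.
have [f fi fc] := bolzano_weierstrass bnd.
have fge k : (k <= f k)%N.
  elim: k => // k IH; apply: leq_ltn_trans IH _.
  by have := fi k.+1 k; rewrite !leEnat ltnn ltnNge => ->.
exists (limn (y_ \o f)) => d d0.
have /cvgrPdist_lt/(_ d d0)[N _ hN] := fc.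
pose n := maxn N (Num.truncn d^-1).+1.
exists (y_ (f n)); first by rewrite distrC; apply: hN; rewrite /= leq_maxl.
have [_ [u [v [e [r [uv eE he]]]]]] := hy (f n); exists u, v, e, r; split=> //.
apply: lt_trans he _; rewrite invf_plt ?posrE//.
apply: (@lt_le_trans _ _ (Num.truncn d^-1).+1%:R); first exact: truncnS_gt.
rewrite ler_nat (leq_trans (leq_maxr N _))// (leq_trans _ (leqnSn _))//.
Qed.

Lemma normr_lin_le (c0 c1 a : R) : `|c0 + c1 * a| <= (`|c0| + `|c1|) * (1 + `|a|).
Proof.
apply: le_trans (ler_normD _ _) _; rewrite normrM.
have := mulr_ge0 (normr_ge0 c0) (normr_ge0 a); have := normr_ge0 c1; lra.
Qed.

(** The quantity is the error made when [1 / (a ^+ 2 + 1)] is traded for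
    [1 / (h ^+ 2 + 1)] and the multiple of [e] is dropped. *)
Lemma small_at_error_bound (c0 c1 u v e a h w : R) : u ^+ 2 + v ^+ 2 = 1 ->
  `|h - a| <= 1 ->
  (h ^+ 2 + 1) * w = 1 - e * (u - v * h) ->
  `|(c0 + c1 * a) / (a ^+ 2 + 1) - (c0 + c1 * a) * w|
    <= 4 * (`|c0| + `|c1|) * (`|e| + `|h - a|).
Proof.
move=> uv ha hw; set l := c0 + c1 * a; set K := `|c0| + `|c1|.
have K0 : 0 <= K by rewrite addr_ge0.
have Da : 0 < a ^+ 2 + 1 by rewrite ltr_pwDr// sqr_ge0.
have Dh : 0 < h ^+ 2 + 1 by rewrite ltr_pwDr// sqr_ge0.
have wE : w = (1 - e * (u - v * h)) / (h ^+ 2 + 1).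
  by rewrite -hw mulrC mulKf// gt_eqF.
have -> : l / (a ^+ 2 + 1) - l * w = e * (l * (u - v * h) / (h ^+ 2 + 1))
    + (h - a) * (l / (a ^+ 2 + 1) * ((h + a) / (h ^+ 2 + 1))).
  by rewrite wE; field; rewrite !gt_eqF.
have ah : `|a| <= `|h| + 1.
  have -> : a = h - (h - a) by rewrite subKr.
  by apply: le_trans (ler_normB _ _) _; rewrite lerD2l.
have u1 : `|u| <= 1 by rewrite -(@expr_le1 _ 2)// real_normK ?num_real// -uv lerDl sqr_ge0.
have v1 : `|v| <= 1 by rewrite -(@expr_le1 _ 2)// real_normK ?num_real// -uv lerDr sqr_ge0.
have la : `|l| <= K * (1 + `|a|) := normr_lin_le c0 c1 a.
have b1 : `|u - v * h| <= 1 + `|h|.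
  apply: le_trans (ler_normB _ _) _; rewrite normrM lerD//.
  by rewrite ler_piMl.
have nDa : `|a ^+ 2 + 1| = `|a| ^+ 2 + 1 by rewrite gtr0_norm// real_normK ?num_real.
have nDh : `|h ^+ 2 + 1| = `|h| ^+ 2 + 1 by rewrite gtr0_norm// real_normK ?num_real.
have h0 := normr_ge0 h; have a0 := normr_ge0 a.
have t1 : `|l * (u - v * h) / (h ^+ 2 + 1)| <= 4 * K.
  rewrite normrM normfV nDh ler_pdivrMr; last by rewrite ltr_pwDr// sqr_ge0.
  rewrite normrM; apply: (@le_trans _ _ (K * (2 + `|h|) * (1 + `|h|))).
    rewrite ler_pM// (le_trans la)// ler_wpM2l//; lra.
  have -> : 4 * K * (`|h| ^+ 2 + 1) = K * (4 * (`|h| ^+ 2 + 1)) by ring.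
  rewrite -mulrA ler_wpM2l//; have := sqr_ge0 (`|h| - 2^-1); nra.
have t2 : `|l / (a ^+ 2 + 1) * ((h + a) / (h ^+ 2 + 1))| <= 4 * K.
  have -> : 4 * K = (2 * K) * 2 by ring.
  rewrite normrM ler_pM//.
    rewrite normrM normfV nDa ler_pdivrMr; last by rewrite ltr_pwDr// sqr_ge0.
    apply: le_trans la _; have -> : 2 * K * (`|a| ^+ 2 + 1) = K * (2 * (`|a| ^+ 2 + 1)) by ring.
    rewrite ler_wpM2l//; have := sqr_ge0 (`|a| - 2^-1); nra.
  rewrite normrM normfV nDh ler_pdivrMr; last by rewrite ltr_pwDr// sqr_ge0.
  apply: le_trans (ler_normD _ _) _; have := sqr_ge0 (`|h| - 2^-1); nra.
apply: le_trans (ler_normD _ _) _; rewrite !normrM mulrDr lerD// mulrC ler_wpM2r//.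
- by move: t1; rewrite !normrM.
- by move: t2; rewrite !normrM.
Qed.

(** Modulo a multiple of [minpoly_addi y], the polynomial [e] is inverted by the
    conjugate residue [b = u - v ('X - y)]: [1 = e * b + minpoly_addi y * w].
    Hence a fraction with denominator power [n.+1] is a fraction with power [n]
    up to an error controlled by [e] and [y - x], the same for both measures.
    The bound [`|e| <= d + e ^+ 2 / d] turns smallness in the moment norm into
    smallness of the integral. *)
Lemma agree_step mu nu s x n : has_moments mu s -> has_moments nu s ->
  (forall d, 0 < d -> exists2 y, `|y - x| < d & small_at s d y) ->
  (forall q, \int[mu]_t (q.[t] / (minpoly_addi x).[t] ^+ n) =
             \int[nu]_t (q.[t] / (minpoly_addi x).[t] ^+ n)) ->
  forall q, \int[mu]_t (q.[t] / (minpoly_addi x).[t] ^+ n.+1) =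
            \int[nu]_t (q.[t] / (minpoly_addi x).[t] ^+ n.+1).
Proof.
move=> mus nus acc agree q; pose D := minpoly_addi x.
have D0 t : 0 < D.[t] := horner_minpoly_addi_gt0 x t.
have [c0 [c1 [q1 [qE _]]]] := poly_mod_sqr_add1 q x.
pose l : {poly R} := c0%:P + c1 *: ('X - x%:P).
have lE t : l.[t] = c0 + c1 * (t - x) by rewrite /l !hornerE.
pose frac (p : {poly R}) k (t : RM) := p.[t] / D.[t] ^+ k.
have fi (m : {measure set RM -> \bar R}) p k : has_moments m s ->
  m.-integrable setT (EFin \o frac p k) := @frac_integrable m s p x k.
suff lagree : \int[mu]_t frac l n.+1 t = \int[nu]_t frac l n.+1 t.
  have split (m : {measure set RM -> \bar R}) : has_moments m s ->
      \int[m]_t frac q n.+1 t = \int[m]_t frac q1 n t + \int[m]_t frac l n.+1 t.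
    move=> ms; rewrite -RintegralD//; [|exact: fi|exact: fi].
    apply: eq_Rintegral => t _; rewrite /frac qE hornerD hornerM -/D -/l exprS.
    by field; rewrite !gt_eqF ?exprn_gt0.
  by rewrite -/(frac q n.+1) !split// lagree; congr +%R; exact: agree.
set K := `|c0| + `|c1|; have K0 : 0 <= K by rewrite addr_ge0.
have s0 : 0 <= s 0%N.
  by have := moment_functional_sqr_ge0 1 mus; rewrite expr1n -polyC1 moment_functionalC mul1r.
suff bound d : 0 < d -> d <= 1 ->
    `|\int[mu]_t frac l n.+1 t - \int[nu]_t frac l n.+1 t| <= d * (2 * (4 * K * (2 * s 0%N + 1))).
  set X := (X in X = _); set Y := (Y in _ = Y).
  apply/eqP; rewrite -subr_eq0 -normr_le0; apply/ler_addgt0Pl => d d0; rewrite addr0.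
  set C := 2 * (4 * K * (2 * s 0%N + 1)) in bound.
  have C0 : 0 <= C by rewrite /C !mulr_ge0// addr_ge0// mulr_ge0.
  pose d' := Num.min 1 (d / (C + 1)).
  have d'0 : 0 < d' by rewrite lt_min ltr01 divr_gt0// ltr_pwDr.
  apply: le_trans (bound d' d'0 _) _; first by rewrite ge_min lexx.
  apply: (@le_trans _ _ (d / (C + 1) * C)).
    by rewrite ler_wpM2r// ge_min lexx orbT.
  by rewrite mulrAC ler_pdivrMr ?ltr_pwDr// ler_pM2l// lerDl.
move=> d0 d1.
have [|y yx [u [v [e [r [uv eE he]]]]]] := acc (d ^+ 2); first by rewrite exprn_gt0.
have {}yx : `|y - x| <= d by rewrite (le_trans (ltW yx))// expr2 ler_piMl// ltW.
pose w : {poly R} := (v ^+ 2)%:P - r * (u%:P - v *: ('X - y%:P)).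
have wE t : ((t - y) ^+ 2 + 1) * w.[t] = 1 - e.[t] * (u - v * (t - y)).
  have -> : 1 - e.[t] * (u - v * (t - y)) =
    (u ^+ 2 + v ^+ 2) - e.[t] * (u - v * (t - y)) by rewrite uv.
  by rewrite /w eE !hornerE /=; ring.
pose g (t : RM) := frac l n.+1 t - frac (l * w) n t.
pose G : {poly R} := (4 * K * (2 * d))%:P + (4 * K / d) *: e ^+ 2.
have gG t : `|g t| <= G.[t].
  have -> : g t = D.[t] ^- n * (l.[t] / D.[t] - l.[t] * w.[t]).
    by rewrite /g /frac hornerM exprS; field; rewrite !gt_eqF ?exprn_gt0.
  rewrite normrM; apply: (@le_trans _ _ `|l.[t] / D.[t] - l.[t] * w.[t]|).
    rewrite ler_piMl// normfV invf_le1 normrX; last by rewrite exprn_gt0// normr_gt0 gt_eqF.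
    by rewrite exprn_ege1// gtr0_norm// horner_minpoly_addi_ge1.
  rewrite lE horner_minpoly_addi.
  have hE : t - y - (t - x) = x - y by ring.
  apply: le_trans (@small_at_error_bound c0 c1 u v e.[t] (t - x) (t - y) w.[t] uv _ (wE t)) _.
    by rewrite hE distrC (le_trans yx).
  rewrite hE distrC -/K /G hornerD hornerC hornerZ horner_exp -(real_normK (num_real e.[t])).
  have -> : 4 * K * (2 * d) + 4 * K / d * `|e.[t]| ^+ 2 =
    4 * K * (d + `|e.[t]| ^+ 2 / d + d) by ring.
  rewrite ler_wpM2l ?mulr_ge0// lerD// -[X in _ <= X + _](@mulfK _ d) ?gt_eqF//.
  rewrite -mulrDl ler_pdivlMr//; have := sqr_ge0 (`|e.[t]| - d).
  have := mulr_ge0 (normr_ge0 e.[t]) (ltW d0); nra.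
have MG : moment_functional s G <= d * (4 * K * (2 * s 0%N + 1)).
  rewrite linearD linearZ/= moment_functionalC -[_ / d * _]mulrA [d^-1 * _]mulrC.
  have : moment_functional s (e ^+ 2) / d <= d by rewrite ler_pdivrMr// -expr2 ltW.
  by move: (_ / d) => z zd; have := mulr_ge0 K0 (ltac:(by rewrite subr_ge0) : 0 <= d - z); lra.
have gi (m : {measure set RM -> \bar R}) : has_moments m s ->
    `|\int[m]_t frac l n.+1 t - \int[m]_t frac (l * w) n t| <= d * (4 * K * (2 * s 0%N + 1)).
  move=> ms; rewrite -RintegralB//; [|exact: fi|exact: fi].
  apply: le_trans MG; apply: (normr_Rintegral_le ms) => //.
  have := integrableB measurableT (fi m l n.+1 ms) (fi m (l * w) n ms).
  by congr (_.-integrable _ _); apply/funext => t; rewrite /= EFinB.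
have Eagree : \int[mu]_t frac (l * w) n t = \int[nu]_t frac (l * w) n t := agree (l * w).
have := gi _ mus; have := gi _ nus; rewrite Eagree.
set X := \int[mu]_t _; set Y := \int[nu]_t frac l _ _; set Z := \int[nu]_t _.
move=> hY hX; have -> : X - Y = (X - Z) - (Y - Z) by ring.
by apply: le_trans (ler_normB _ _) _; lra.
Qed.

(** Two measures with the moments [s] give the same integrals to all fractions
    over powers of [minpoly_addi x], by induction on the power. *)
Theorem measure_eq_no_gap mu nu s : has_moments mu s -> has_moments nu s ->
  (forall c, 0 < c -> exists p, moment_functional s (p ^+ 2) < c * sum_sqr_coef p) ->
  forall A : set RM, measurable A -> mu A = nu A.
Proof.
move=> mus nus small; have [x acc] := small_at_accumulation mus small.
apply: (@measure_eq_rational _ mu nu s x) => // q n; elim: n q => [|n IH] q.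
  under eq_Rintegral do rewrite expr0 divr1.
  under [RHS]eq_Rintegral do rewrite expr0 divr1.
  by rewrite (moments_poly q mus).2 (moments_poly q nus).2.
exact: (agree_step mus nus).
Qed.

End Determinacy.

(** * Nonnegative polynomials *)

Section SumOfSquares.
Local Open Scope complex_scope.
Variable R : realType.
Implicit Types (p q : {poly R}).

Lemma poly_ge0_at_right p (a : R) : (forall t, a < t -> 0 <= p.[t]) -> 0 <= p.[a].
Proof.
move=> h; have : p.[t] @[t --> a^'+] --> p.[a].
  by apply: cvg_at_right_filter; exact: continuous_horner.
by move=> /cvgr_to_ge; apply; near=> t; apply: h.
Unshelve. all: by end_near. Qed.

Lemma poly_le0_at_left p (a : R) : (forall t, t < a -> p.[t] <= 0) -> p.[a] <= 0.
Proof.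
move=> h; have : p.[t] @[t --> a^'-] --> p.[a].
  by apply: cvg_at_left_filter; exact: continuous_horner.
by move=> /cvgr_to_le; apply; near=> t; apply: h.
Unshelve. all: by end_near. Qed.

Lemma nonneg_real_rootP p (a : R) : (forall t, 0 <= p.[t]) -> root p a ->
  exists2 q, p = ('X - a%:P) ^+ 2 * q & forall t, 0 <= q.[t].
Proof.
move=> p0 /factor_theorem[q pE].
have qE t : p.[t] = q.[t] * (t - a) by rewrite pE !hornerE.
have qa : root q a.
  rewrite rootE eq_le; apply/andP; split.
  - by apply: poly_le0_at_left => t ta; have := p0 t; rewrite qE nmulr_lge0 ?subr_lt0.
  - by apply: poly_ge0_at_right => t ta; have := p0 t; rewrite qE pmulr_lge0 ?subr_gt0.
have [r qr] := factor_theorem _ _ qa; exists r; first by rewrite pE qr; ring.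
have rge t : t != a -> 0 <= r.[t].
  move=> ta; have := p0 t; rewrite pE qr !hornerE -mulrA -expr2 pmulr_lge0//.
  by rewrite exprn_even_gt0//= subr_eq0.
move=> t; have [->|/rge//] := eqVneq t a.
by apply: poly_ge0_at_right => u au; rewrite rge// gt_eqF.
Qed.

Lemma nonneg_complex_rootP p (a b : R) : (forall t, 0 <= p.[t]) -> b != 0 ->
  root (map_poly (real_complex R) p) (Complex a b) ->
  exists2 q, p = (('X - a%:P) ^+ 2 + (b%:P) ^+ 2) * q & forall t, 0 <= q.[t].
Proof.
move=> p0 b0 pz; set D := ('X - a%:P) ^+ 2 + (b%:P) ^+ 2.
have szD : size D = 3.
  by rewrite /D size_polyDl ?size_exp_XsubC// -polyC_exp size_polyC; case: eqP.
have D0 : D != 0 by rewrite -size_poly_eq0 szD.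
have Dt t : D.[t] = (t - a) ^+ 2 + b ^+ 2 by rewrite !hornerE.
have sm : (size (modp p D) <= 2)%N by have := ltn_modp p D; rewrite D0 szD ltnS.
pose c0 := (modp p D)`_0; pose c1 := (modp p D)`_1.
have mE : modp p D = c0%:P + c1 *: 'X.
  apply/polyP => i; rewrite coefD coefC coefZ coefX.
  case: i => [|[|i]] /=; rewrite ?mulr1 ?add0r ?mulr0 ?addr0//.
  by move/leq_sizeP: sm => ->.
have m0 : modp p D = 0.
  move: pz; rewrite rootE {1}(divp_eq p D) mE rmorphD/= rmorphM/= hornerD hornerM.
  have -> : (map_poly (real_complex R) D).[Complex a b] = 0.
    rewrite /D rmorphD !rmorphXn/= rmorphB/= map_polyX !map_polyC !hornerE.
    have -> : Complex a b - a%:C = Complex 0 b :> R[i] by apply/eqP; rewrite eq_complex/= subrr subr0 !eqxx.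
    by apply/eqP; rewrite !expr2 eq_complex/=; apply/andP; split; apply/eqP; ring.
  rewrite mulr0 add0r rmorphD/= map_polyC map_polyZ/= map_polyX/= !hornerE.
  rewrite eq_complex/= => /andP[/eqP h1 /eqP h2].
  have c1b : c1 * b = 0 by move: h2; rewrite !(mul0r, mulr0, add0r, addr0).
  have c10 : c1 = 0 by move/eqP: c1b; rewrite mulf_eq0 (negPf b0) orbF => /eqP.
  move: h1; rewrite c10 !(mul0r, mulr0, subr0, addr0) => c00.
  by rewrite c00 scale0r addr0.
exists (divp p D); first by rewrite {1}(divp_eq p D) m0 addr0 mulrC.
move=> t; have := p0 t; rewrite {1}(divp_eq p D) m0 addr0 hornerM Dt pmulr_lge0//.
by rewrite ltr_wpDl ?sqr_ge0// exprn_even_gt0.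
Qed.

(** A real root of a nonnegative polynomial has even multiplicity, and a pair
    of conjugate roots contributes a factor which is a sum of two squares;
    these sums are closed under products. *)
Lemma nonneg_poly_sum_sqr p : (forall t, 0 <= p.[t]) ->
  exists A B : {poly R}, p = A ^+ 2 + B ^+ 2.
Proof.
have [n] := ubnP (size p); elim: n p => // n IH p pn p0.
have [p1|p1] := leqP (size p) 1.
  exists (Num.sqrt p`_0)%:P, 0; rewrite expr0n addr0 -polyC_exp sqr_sqrtr.
    exact: size1_polyC.
  by have := p0 0; rewrite horner_coef0.
have [z pz] : exists z, root (map_poly (real_complex R) p) z.
  by apply/closed_rootP; rewrite size_map_poly; apply: contraTneq p1 => ->.
have pn0 : p != 0 by rewrite -size_poly_gt0 (leq_trans _ p1).
case: z pz => a b pz; have [b0|b0] := eqVneq b 0.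
  have pa : root p a by move: pz; rewrite b0 rootE horner_map/= fmorph_eq0.
  have [q pE q0] := nonneg_real_rootP p0 pa.
  have qn : (size q < n)%N.
    rewrite -ltnS (leq_trans _ pn)// pE size_monicM ?monic_exp ?monicXsubC//.
      by rewrite size_exp_XsubC.
    by apply: contraNneq pn0 => q00; rewrite pE q00 mulr0.
  have [A [B AB]] := IH q qn q0; exists (('X - a%:P) * A), (('X - a%:P) * B).
  by rewrite pE AB; ring.
have [q pE q0] := nonneg_complex_rootP p0 b0 pz.
have szD : size (('X - a%:P) ^+ 2 + (b%:P) ^+ 2 : {poly R}) = 3.
  by rewrite size_polyDl ?size_exp_XsubC// -polyC_exp size_polyC; case: eqP.
have qn : (size q < n)%N.
  have q00 : q != 0 by apply: contraNneq pn0 => q00; rewrite pE q00 mulr0.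
  have D0 : ('X - a%:P) ^+ 2 + (b%:P) ^+ 2 != 0 :> {poly R} by rewrite -size_poly_eq0 szD.
  by rewrite -ltnS (leq_trans _ pn)// pE size_mul// szD.
have [A [B AB]] := IH q qn q0.
exists (('X - a%:P) * A - b%:P * B), (('X - a%:P) * B + b%:P * A).
by rewrite pE AB; ring.
Qed.

Lemma moment_functional_ge0 (s : nat -> R) p :
  (forall q, 0 <= moment_functional s (q ^+ 2)) -> (forall t, 0 <= p.[t]) ->
  0 <= moment_functional s p.
Proof.
by move=> s0 /nonneg_poly_sum_sqr[A [B ->]]; rewrite linearD; apply: addr_ge0; exact: s0.
Qed.

End SumOfSquares.

(** * Dominated extension of linear functionals *)

Section HahnBanach.
Variables (R : realType) (V : lmodType R) (dom : set V).
Hypothesis domD : forall f g, dom f -> dom g -> dom (f + g).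
Hypothesis domZ : forall c f, dom f -> dom (c *: f).

Lemma lb_le_infD (A B : set R) (x : R) : A !=set0 -> B !=set0 ->
  (forall a b, A a -> B b -> x <= a + b) -> x <= inf A + inf B.
Proof.
move=> A0 B0 h; rewrite -lerBlDr; apply: lb_le_inf => // a Aa.
rewrite lerBlDr addrC -lerBlDr; apply: lb_le_inf => // b Bb.
by rewrite lerBlDr addrC h.
Qed.

Definition sublinear_on (S : V -> R) :=
  (forall f g, dom f -> dom g -> S (f + g) <= S f + S g) /\
  (forall c f, 0 < c -> dom f -> S (c *: f) <= c * S f).

Lemma domN f : dom f -> dom (- f).
Proof. by move=> df; rewrite -scaleN1r; exact: domZ. Qed.

Lemma sublinear0 S : sublinear_on S -> dom 0 -> S 0 = 0.
Proof.
move=> [SD SZ] d0; apply/eqP; rewrite eq_le; apply/andP; split.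
- have := SZ 2^-1 0 ltac:(by rewrite invr_gt0) d0; rewrite scaler0; lra.
- have := SD 0 0 d0 d0; rewrite addr0; lra.
Qed.

Lemma sublinearN_ge S f : sublinear_on S -> dom f -> - S (- f) <= S f.
Proof.
move=> Ssub df; have df' := domN df; rewrite -subr_ge0 opprK.
have := Ssub.1 _ _ df df'; rewrite subrr sublinear0//.
by have := domD df df'; rewrite subrr.
Qed.

(** The pointwise infimum of a chain of sublinear functionals is sublinear, so
    there is a minimal one below [q]. *)
Lemma minimal_sublinear (q : V -> R) : sublinear_on q ->
  exists S, [/\ sublinear_on S, forall f, dom f -> S f <= q f &
    forall S', sublinear_on S' -> (forall f, dom f -> S' f <= S f) ->
      forall f, dom f -> S f <= S' f].
Proof.
move=> qsub; pose P (S : V -> R) := sublinear_on S /\ forall f, dom f -> S f <= q f.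
pose T := {S : V -> R | P S}.
pose below (S S' : T) := `[< forall f, dom f -> sval S' f <= sval S f >].
have Pq : P q by [].
have [|||[S [Ssub Sq]] Smin] := @ZL_preorder T (exist _ q Pq) below.
- by move=> S; apply/asboolP.
- move=> S1 S2 S3 /asboolP h1 /asboolP h2; apply/asboolP => f df.
  exact: le_trans (h2 f df) (h1 f df).
- move=> A Atot; have [[S0 AS0]|A0] := pselect (A !=set0); last first.
    by exists (exist _ q Pq) => S AS; exfalso; apply: A0; exists S.
  pose I f := inf [set sval S f | S in A].
  have In0 f : [set sval S f | S in A] !=set0 by exists (sval S0 f), S0.
  have Ile f S : dom f -> A S -> I f <= sval S f.
    move=> df AS; apply: ge_inf; last by exists S.
    exists (- q (- f)) => _ [S1 AS1 <-]; apply: le_trans (sublinearN_ge (svalP S1).1 df).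
    by rewrite lerN2; apply: (svalP S1).2; exact: domN.
  have PI : P I.
    split; last by move=> f df; apply: le_trans (Ile f S0 df AS0) ((svalP S0).2 f df).
    split=> [f g df dg|c f c0 df].
    + apply: lb_le_infD => // _ _ [S1 AS1 <-] [S2 AS2 <-].
      have [/asboolP h|/asboolP h] := Atot _ _ AS1 AS2.
      * apply: le_trans (Ile _ _ (domD df dg) AS2) _.
        by apply: le_trans ((svalP S2).1.1 f g df dg) _; rewrite lerD2r h.
      * apply: le_trans (Ile _ _ (domD df dg) AS1) _.
        by apply: le_trans ((svalP S1).1.1 f g df dg) _; rewrite lerD2l h.
    + rewrite -ler_pdivrMl//; apply: lb_le_inf => // _ [S1 AS1 <-].
      rewrite ler_pdivrMl//; apply: le_trans (Ile _ _ (domZ c df) AS1) _.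
      exact: (svalP S1).1.2.
  by exists (exist _ I PI) => S AS; apply/asboolP => f df; exact: Ile.
- exists S; split=> // S' S'sub S'S f df.
  have PS' : P S' by split=> // g dg; exact: le_trans (S'S g dg) (Sq g dg).
  have /asboolP := Smin (exist _ S' PS') (asboolT S'S).
  exact.
Qed.

(** A minimal sublinear functional [S] is odd, hence linear: the infimum over
    [t >= 0] of [S (f + t *: g) - t * S g] is again sublinear and below [S], and
    at [f = - g] it is at most [- S g]. *)
Lemma hahn_banach (q : V -> R) : sublinear_on q ->
  exists E : V -> R, [/\ forall f, dom f -> E f <= q f,
    forall f g, dom f -> dom g -> E (f + g) = E f + E g &
    forall c f, dom f -> E (c *: f) = c * E f].
Proof.
move=> /minimal_sublinear[S [Ssub Sq Smin]].
have SN g : dom g -> S (- g) = - S g.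
  move=> dg; apply/eqP; rewrite eq_le; apply/andP; split; last first.
    by rewrite lerNl sublinearN_ge.
  pose A f := [set S (f + t *: g) - t * S g | t in [set t : R | 0 <= t]].
  have A0 f : A f !=set0 by exists (S (f + 0 *: g) - 0 * S g), 0 => //=.
  have Ale f t : dom f -> 0 <= t -> inf (A f) <= S (f + t *: g) - t * S g.
    move=> df t0; apply: ge_inf; last by exists t.
    exists (- S (- f)) => _ [u /= u0 <-].
    have [->|u_neq0] := eqVneq u 0.
      by rewrite scale0r addr0 mul0r subr0 sublinearN_ge.
    have up : 0 < u by rewrite lt_def u_neq0.
    have dug := domZ u dg.
    have h1 := Ssub.1 _ _ (domD df dug) (domN df).
    have h2 := Ssub.2 u^-1 _ ltac:(by rewrite invr_gt0) dug.
    rewrite scalerA mulVf// scale1r ler_pdivlMl// in h2.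
    by rewrite addrAC subrr add0r in h1; lra.
  pose S' f := inf (A f).
  have S'S f : dom f -> S' f <= S f.
    by move=> df; have := Ale f 0 df (lexx _); rewrite scale0r addr0 mul0r subr0.
  have S'sub : sublinear_on S'.
    split=> [f1 f2 d1 d2|c f c0 df].
    - apply: lb_le_infD => // _ _ [t1 /= t10 <-] [t2 /= t20 <-].
      apply: le_trans (Ale _ (t1 + t2) (domD d1 d2) (addr_ge0 t10 t20)) _.
      have := Ssub.1 _ _ (domD d1 (domZ t1 dg)) (domD d2 (domZ t2 dg)).
      by rewrite addrACA -scalerDl; lra.
    - rewrite -ler_pdivrMl//; apply: lb_le_inf => // _ [t /= t0 <-].
      rewrite ler_pdivrMl//.
      apply: le_trans (Ale _ (c * t) (domZ c df) (mulr_ge0 (ltW c0) t0)) _.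
      have := Ssub.2 c _ c0 (domD df (domZ t dg)).
      by rewrite scalerDr scalerA; lra.
  have dNg := domN dg.
  apply: le_trans (Smin S' S'sub S'S _ dNg) _.
  have := Ale (- g) 1 dNg ler01; rewrite scale1r addNr mul1r sublinear0 ?sub0r//.
  by have := domD dg dNg; rewrite subrr.
have SZ c f : 0 < c -> dom f -> S (c *: f) = c * S f.
  move=> c0 df; apply/eqP; rewrite eq_le Ssub.2//=.
  have := Ssub.2 c^-1 _ ltac:(by rewrite invr_gt0) (domZ c df).
  by rewrite scalerA mulVf ?gt_eqF// scale1r ler_pdivlMl.
exists S; split=> // [f g df dg|c f df].
- apply/eqP; rewrite eq_le Ssub.1//=.
  have := Ssub.1 _ _ (domN df) (domN dg); rewrite -opprD !SN//; last exact: domD.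
  lra.
- have [c0|c0|->] := ltgtP c 0.
  + rewrite -[c]opprK scaleNr SN; last exact: domZ.
    by rewrite SZ ?oppr_gt0// !mulNr.
  + exact: SZ.
  + rewrite scale0r mul0r sublinear0//; have := domZ 0 df; by rewrite scale0r.
Qed.

End HahnBanach.

(** * Positive extension of the moment functional *)

Section PositiveExtension.
Variable R : realType.
Implicit Types (s : nat -> R) (p : {poly R}) (f g : R -> R).

Definition poly_dominated f := exists p, forall t, `|f t| <= p.[t].

Lemma poly_dominatedD f g :
  poly_dominated f -> poly_dominated g -> poly_dominated (fun t => f t + g t).
Proof.
move=> [p hp] [q hq]; exists (p + q) => t.
by rewrite hornerD (le_trans (ler_normD _ _))// lerD.
Qed.

Lemma poly_dominatedZ c f : poly_dominated f -> poly_dominated (fun t => c * f t).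
Proof. by move=> [p hp]; exists (`|c| *: p) => t; rewrite hornerZ normrM ler_wpM2l. Qed.

Lemma poly_dominated_horner p : poly_dominated (horner p).
Proof.
exists (p ^+ 2 + 1) => t; rewrite hornerD horner_exp hornerC.
by rewrite -(real_normK (num_real p.[t])); have := sqr_ge0 (`|p.[t]| - 1); have := normr_ge0 p.[t]; nra.
Qed.

Lemma poly_dominated_le f p : (forall t, 0 <= f t <= p.[t]) -> poly_dominated f.
Proof. by move=> h; exists p => t; have /andP[h0 h1] := h t; rewrite ger0_norm. Qed.

(** The sublinear functional is the least value of the moment functional on the
    polynomials above a given function; it extends the moment functional, and
    lying below it forces positivity. *)
Theorem positive_extension s : (forall p, 0 <= moment_functional s (p ^+ 2)) ->
  exists E : (R -> R) -> R,
  [/\ forall f g, poly_dominated f -> poly_dominated g ->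
        E (fun t => f t + g t) = E f + E g,
      forall c f, poly_dominated f -> E (fun t => c * f t) = c * E f,
      forall p, E (horner p) = moment_functional s p &
      forall f g, poly_dominated f -> poly_dominated g -> (forall t, f t <= g t) ->
        E f <= E g].
Proof.
move=> s_sqr; have s_pos p := @moment_functional_ge0 R s p s_sqr.
have s_mono p q : (forall t, p.[t] <= q.[t]) -> moment_functional s p <= moment_functional s q.
  by move=> pq; rewrite -subr_ge0 -linearB; apply: s_pos => t; rewrite hornerD hornerN subr_ge0.
pose V := R -> R^o.
pose A f := [set moment_functional s p | p in [set p : {poly R} | forall t, f t <= p.[t]]].
pose q (f : V) := inf (A f).
have A0 f : poly_dominated f -> A f !=set0.
  move=> [p hp]; exists (moment_functional s p), p => //= t.
  exact: le_trans (ler_norm _) (hp t).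
have Ale f p : poly_dominated f -> (forall t, f t <= p.[t]) -> inf (A f) <= moment_functional s p.
  move=> [p0 hp0] fp; apply: ge_inf; last by exists p.
  exists (moment_functional s (- p0)) => _ [p1 /= hp1 <-]; apply: s_mono => t.
  apply: le_trans (hp1 t); rewrite hornerN lerNl; apply: le_trans (hp0 t).
  by rewrite -normrN ler_norm.
have dD (f g : V) : poly_dominated f -> poly_dominated g -> poly_dominated (f + g).
  exact: poly_dominatedD.
have dZ c (f : V) : poly_dominated f -> poly_dominated (c *: f).
  exact: poly_dominatedZ.
have qsub : sublinear_on (poly_dominated : set V) q.
  split=> [f g df dg|c f c0 df].
  - apply: lb_le_infD; [exact: A0|exact: A0|] => _ _ [p1 /= h1 <-] [p2 /= h2 <-].
    rewrite -linearD; apply: Ale; first exact: dD.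
    by move=> t; rewrite hornerD lerD.
  - rewrite -ler_pdivrMl//; apply: lb_le_inf; first exact: A0.
    move=> _ [p /= hp <-]; rewrite ler_pdivrMl// -linearZ; apply: Ale; first exact: dZ.
    by move=> t; rewrite hornerZ ler_wpM2l// ltW.
have [E [Eq ED EZ]] := hahn_banach dD dZ qsub.
have Epoly p : E (horner p) = moment_functional s p.
  have le r : E (horner r) <= moment_functional s r.
    apply: le_trans (Eq _ (poly_dominated_horner r)) _.
    exact: Ale (poly_dominated_horner r) _.
  apply/eqP; rewrite eq_le le/=.
  have := le (- p); rewrite linearN.
  have -> : horner (- p) = ((-1 : R) *: (horner p : V) : V).
    by apply/funext => t; rewrite hornerN; apply/esym/mulN1r.
  rewrite EZ; last exact: poly_dominated_horner.
  by rewrite mulN1r lerN2.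
exists E; split=> // f g df dg fg; have dNg := dZ (-1) g dg.
have := Eq _ (dD _ _ df dNg); rewrite ED// EZ// mulN1r => h.
rewrite -subr_le0; apply: le_trans h _.
rewrite -(linear0 (moment_functional s)); apply: Ale; first exact: dD.
move=> t; rewrite horner0.
have -> : (f + (-1 : R) *: (g : V)) t = f t - g t by exact: (congr1 (fun z => f t + z) (mulN1r (g t))).
by rewrite subr_le0.
Qed.

End PositiveExtension.

(** * Measures from monotone functions *)

Section RightRegularization.
Variable R : realType.
Local Notation RM := (measurableTypeR R).
Implicit Types (F G : R -> R).

Definition right_lim F (a : R) : R := inf [set F b | b in [set b | a < b]].

Section Basics.
Variable F : R -> R.
Hypothesis F_nd : {homo F : x y / x <= y}.

Let values (a : R) : has_inf [set F b | b in [set b | a < b]].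
Proof.
split; first by exists (F (a + 1)), (a + 1) => //=; rewrite ltrDl.
by exists (F a) => _ [b /= ab <-]; apply: F_nd; exact: ltW.
Qed.

Lemma right_lim_le a b : a < b -> right_lim F a <= F b.
Proof. by move=> ab; apply: ge_inf; [exact: (values a).2|exists b]. Qed.

Lemma right_lim_ge a : F a <= right_lim F a.
Proof. by apply: lb_le_inf; [exact: (values a).1|move=> _ [b /= ab <-]; exact/F_nd/ltW]. Qed.

Lemma right_lim_nd : {homo right_lim F : x y / x <= y}.
Proof.
move=> x y xy; apply: lb_le_inf; first exact: (values y).1.
by move=> _ [b /= yb <-]; apply: right_lim_le; exact: le_lt_trans xy yb.
Qed.

Lemma right_lim_near a e : 0 < e ->
  exists2 d, 0 < d & forall h, h <= d -> F (a + h) < right_lim F a + e.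
Proof.
move=> e0; have [_ [b /= ab <-] hb] := inf_adherent e0 (values a).
exists (b - a); first by rewrite subr_gt0.
by move=> h hd; apply: le_lt_trans hb; apply: F_nd; lra.
Qed.

Lemma right_lim_right_continuous : forall a, right_lim F x @[x --> a^'+] --> right_lim F a.
Proof.
move=> a; apply/cvgrPdist_lt => e e0; have [d d0 hd] := right_lim_near a e0.
near=> x; have ax : a < x by near: x; exact: nbhs_right_gt.
have xd : x < a + d by near: x; apply: nbhs_right_lt; rewrite ltrDl.
rewrite distrC ger0_norm ?subr_ge0; last by apply: right_lim_nd; exact: ltW.
rewrite ltrBlDl; apply: le_lt_trans (hd d (lexx _)).
exact: right_lim_le.
Unshelve. all: by end_near. Qed.

Lemma stieltjes_measure_exists : exists mu : {measure set RM -> \bar R},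
  forall a b, a <= b -> mu `]a, b]%classic = (right_lim F b - right_lim F a)%:E.
Proof.
pose G : cumulative R R := HB.pack_for (cumulative R R) (right_lim F)
  (isCumulative.Build R _ R (right_lim F) right_lim_nd right_lim_right_continuous).
exists (lebesgue_stieltjes_measure G) => a b ab.
transitivity (wlength G `]a, b]%classic); last exact: wlength_itv_bnd.
by apply: (@measurable_mu_extE _ _ _ (wlength G)); exact: is_ocitv.
Qed.

End Basics.

Lemma right_lim_density F G (p : {poly R}) (a b b' m : R) :
  {homo F : x y / x <= y} -> {homo G : x y / x <= y} ->
  (forall a b m, a <= b -> 0 <= m -> (forall t, a < t <= b -> m <= p.[t]) ->
    m * (F b - F a) <= G b - G a) ->
  a <= b -> b < b' -> 0 <= m -> (forall t, a < t <= b' -> m <= p.[t]) ->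
  m * (right_lim F b - right_lim F a) <= right_lim G b - right_lim G a.
Proof.
move=> Fnd Gnd dens ab bb' m0 mp; apply/ler_addgt0Pr => e e0.
have e1 : 0 < e / (2 * (m + 1)) by rewrite divr_gt0// mulr_gt0// ltr_wpDl.
have [d1 d10 h1] := right_lim_near Fnd a e1.
have [d2 d20 h2] := right_lim_near Gnd b (divr_gt0 e0 (ltr0Sn _ 1)).
pose h := Num.min (Num.min d1 d2) (b' - b).
have h0 : 0 < h by rewrite !lt_min d10 d20 subr_gt0.
have hd1 : h <= d1 by rewrite !ge_min lexx.
have hd2 : h <= d2 by rewrite !ge_min lexx orbT.
have hb : h <= b' - b by rewrite ge_min lexx orbT.
have {}h1 := h1 h hd1; have {}h2 := h2 h hd2.
have H := dens (a + h) (b + h) m ltac:(by rewrite lerD2r) m0.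
have {}H : m * (F (b + h) - F (a + h)) <= G (b + h) - G (a + h).
  by apply: H => t /andP[t1 t2]; apply: mp; apply/andP; split; lra.
have k1 : right_lim F b <= F (b + h) by apply: right_lim_le => //; rewrite ltrDl.
have k2 : right_lim G a <= G (a + h) by apply: right_lim_le => //; rewrite ltrDl.
have k3 : m * (e / (2 * (m + 1))) <= e / 2.
  rewrite mulrA ler_pdivrMr ?mulr_gt0 ?ltr_wpDl//.
  have -> : e / 2 * (2 * (m + 1)) = m * e + e by field.
  by rewrite lerDl ltW.
apply: (@le_trans _ _ (m * (F (b + h) - F (a + h) + e / (2 * (m + 1))))).
  by rewrite ler_wpM2l//; lra.
by rewrite mulrDr; lra.
Qed.

(** Lower Riemann sums over half-open cells; each minimum is taken over a cell
    and its right neighbour, so that the cell may be shifted slightly to the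
    right, where the one-sided limits are approximated. *)
Lemma integral_poly_le F G (p : {poly R}) (C : R) (mu : {measure set RM -> \bar R}) :
  {homo F : x y / x <= y} -> {homo G : x y / x <= y} ->
  (forall a b m, a <= b -> 0 <= m -> (forall t, a < t <= b -> m <= p.[t]) ->
    m * (F b - F a) <= G b - G a) ->
  (forall a, 0 <= G a <= C) -> (forall t, 0 <= p.[t]) ->
  (forall a b, a <= b -> mu `]a, b]%classic = (right_lim F b - right_lim F a)%:E) ->
  (\int[mu]_x (p.[x])%:E <= C%:E)%E.
Proof.
move=> Fnd Gnd dens GC p0 muE.
(* cells of length [1 / n.+1] covering the interval ]- n.+1, n.+1] *)
pose t n j : R := j%:R / n.+1%:R - n.+1%:R.
pose N n := (n.+1 * n.+1 * 2)%N.
pose I n j : set RM := `]t n j, t n j.+1]%classic.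
pose m n j := inf (horner p @` `[t n j, t n j.+2]%classic).
have n0 n : 0 < n.+1%:R :> R by [].
have tS n j : t n j.+1 = t n j + n.+1%:R^-1.
  by rewrite /t -[j.+1]addn1 natrD mulrDl mul1r addrAC.
have tlt n j : t n j < t n j.+1 by rewrite tS ltrDl invr_gt0.
have lb n j : lbound (horner p @` `[t n j, t n j.+2]%classic) 0 by move=> _ [x _ <-].
have m_ge0 n j : 0 <= m n j.
  apply: lb_le_inf => //; exists p.[t n j], (t n j) => //=.
  by rewrite in_itv/= lexx/= (ltW (lt_trans (tlt _ _) (tlt _ _))).
have m_le n j x : t n j < x <= t n j.+2 -> m n j <= p.[x].
  move=> /andP[x1 x2]; apply: ge_inf; first by exists 0; exact: lb.
  by exists x => //=; rewrite in_itv/= x2 ltW.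
pose g n (x : RM) : R := \sum_(j < N n) m n j * \1_(I n j) x.
have g_ge0 n x : 0 <= g n x by rewrite sumr_ge0// => j _; rewrite mulr_ge0.
have g_le n (j : 'I_(N n)) x : I n j x -> m n j <= g n x.
  move=> Ix; rewrite /g (bigD1 j)//= indicE mem_set// mulr1 lerDl.
  by rewrite sumr_ge0// => i _; rewrite mulr_ge0.
have mI n j : measurable (I n j) by exact: measurable_itv.
have mg n : measurable_fun setT (g n).
  by apply: measurable_sum => j; apply: measurable_funM.
have int_g n : (\int[mu]_x (g n x)%:E <= C%:E)%E.
  have -> : (\int[mu]_x (g n x)%:E =
      (\sum_(j < N n) m n j * (right_lim F (t n j.+1) - right_lim F (t n j)))%:E)%E.
    under eq_integral do rewrite /g -sumEFin.
    rewrite ge0_integral_sum//.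
    - rewrite -sumEFin; apply: eq_bigr => j _.
      under eq_integral do rewrite EFinM.
      rewrite ge0_integralZl_EFin//.
      + by rewrite integral_indic// setIT muE ?EFinM// ltW.
      + exact/measurable_EFinP.
    - by move=> j; apply/measurable_EFinP/measurable_funM.
    - by move=> j x _; rewrite lee_fin mulr_ge0.
  rewrite lee_fin.
  apply: (@le_trans _ _ (\sum_(j < N n) (right_lim G (t n j.+1) - right_lim G (t n j)))).
    apply: ler_sum => j _; apply: (@right_lim_density F G p _ _ (t n j.+2)) => //.
    - exact: ltW.
    - exact: m_le.
  rewrite -(big_mkord xpredT (fun j => right_lim G (t n j.+1) - right_lim G (t n j))).
  rewrite telescope_sumr//.
  have := right_lim_ge Gnd (t n 0); have /andP[G0 _] := GC (t n 0).
  have := right_lim_le Gnd (ltac:(by rewrite ltrDl) : t n (N n) < t n (N n) + 1).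
  have /andP[_ G1] := GC (t n (N n) + 1); lra.
(* capping by [p] gives convergence from the lower bound on [g n] alone *)
pose f n (x : RM) : \bar R := (Num.min p.[x] (g n x))%:E.
have fcvg x : f n x @[n --> \oo] --> (p.[x])%:E.
  apply: cvg_EFin; first exact: nearW.
  apply/cvgrPdist_le => e e0 /=.
  have /cvgrPdist_le/(_ e e0)/nbhs_ballP[d /= d0 hd] := @continuous_horner R p x.
  near=> n.
  have xn : `|x| < n.+1%:R.
    near: n; exists (Num.truncn `|x|).+1 => //= k hk.
    apply: lt_trans (truncnS_gt _) _; rewrite ltr_nat ltnS//.
  have nd : 2 / n.+1%:R < d.
    near: n; exists (Num.truncn (2 / d)).+1 => //= k hk.
    rewrite ltr_pdivrMr// mulrC -ltr_pdivrMr//.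
    apply: lt_trans (truncnS_gt _) _; rewrite ltr_nat ltnS//.
  have [j [jN xj]] : exists j, (j < N n)%N /\ t n j < x <= t n j.+1.
    have tN : t n (N n) = n.+1%:R.
      rewrite /t /N !natrM; move: (n0 n); move: (n.+1%:R : R) => K K0; field; by rewrite gt_eqF.
    have ex : exists j, x <= t n j by exists (N n); rewrite tN ltW// (le_lt_trans (ler_norm _)).
    have [j xj jmin] := ex_minnP ex.
    case: j xj jmin => [xj _|j xj jmin].
      exfalso; move: xj; rewrite /t mul0r sub0r leNgt => /negP; apply.
      by move: xn; rewrite ltr_norml => /andP[].
    exists j; split; first by apply: jmin; rewrite tN ltW// (le_lt_trans (ler_norm _)).
    by rewrite xj andbT ltNge; apply/negP => /jmin; rewrite ltnn.
  have pm : p.[x] - e <= m n j.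
    apply: lb_le_inf.
      exists p.[t n j], (t n j) => //=.
      by rewrite in_itv/= lexx/= (ltW (lt_trans (tlt _ _) (tlt _ _))).
    move=> _ [y /= + <-]; rewrite in_itv/= !tS => /andP[y1 y2].
    have /hd : ball x d y.
      rewrite /ball/= ltr_norml; move: xj; rewrite tS => /andP[x1 x2].
      have k0 : 0 < n.+1%:R^-1 :> R by rewrite invr_gt0.
      move: nd y1 y2 x1 x2 k0; rewrite mulr_natl mulr2n.
      by move: (n.+1%:R^-1 : R) (t n j) => k u *; apply/andP; split; lra.
    by rewrite ler_norml => /andP[]; lra.
  have gm : m n j <= g n x.
    by apply: (g_le n (Ordinal jN)); rewrite /I/= in_itv.
  rewrite ger0_norm ?subr_ge0 ?ge_min ?lexx//.
  by rewrite lerBlDl -lerBlDr le_min; apply/andP; split; lra.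
have -> : (\int[mu]_x (p.[x])%:E = \int[mu]_x limn_einf (f^~ x))%E.
  by apply: eq_integral => x _; rewrite (cvg_limn_einf_sup (fcvg x)).
apply: le_trans (fatou _ measurableT _ _) _.
- move=> n; apply/measurable_EFinP; apply: measurable_minr => //.
  exact: measurable_horner.
- by move=> n x _; rewrite lee_fin le_min p0 g_ge0.
rewrite limn_einf_lim; apply: lime_le; first exact: is_cvg_einfs.
apply: nearW => n; apply: le_trans (int_g n).
apply: (@le_trans _ _ (\int[mu]_x f n x)%E).
  by apply: ereal_inf_lbound; exists n => //=.
apply: ge0_le_integral => //.
- by move=> x _; rewrite lee_fin le_min p0 g_ge0.
- apply/measurable_EFinP; apply: measurable_minr => //; exact: measurable_horner.
- exact/measurable_EFinP.
- by move=> x _; rewrite lee_fin ge_min lexx orbT.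
Unshelve. all: by end_near. Qed.

End RightRegularization.

(** * Existence in the Hamburger moment problem *)

Section Hamburger.
Variable R : realType.
Local Notation RM := (measurableTypeR R).
Implicit Types (s : nat -> R) (p q : {poly R}) (mu nu : {measure set RM -> \bar R}).

(** The distribution function of the sought measure is the positive extension
    evaluated at indicators of half-lines. *)
Lemma measure_poly_le_exists s : (forall p, 0 <= moment_functional s (p ^+ 2)) ->
  exists mu, (forall p, (forall t, 0 <= p.[t]) ->
      (\int[mu]_x (p.[x])%:E <= (moment_functional s p)%:E)%E) /\
    ((s 0%N)%:E <= mu setT)%E.
Proof.
move=> s_sqr; have [E [ED EZ Epoly Emono]] := positive_extension s_sqr.
pose ind (a t : R) : R := (t <= a)%R%:R.
have ind01 a t : 0 <= ind a t <= 1 by rewrite /ind ler0n lern1 leq_b1.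
have dmul p a : (forall t, 0 <= p.[t]) -> poly_dominated (fun t => p.[t] * ind a t).
  move=> p0; apply: (@poly_dominated_le _ _ p) => t; have /andP[i0 i1] := ind01 a t.
  by rewrite mulr_ge0//= ler_piMr.
have dind a : poly_dominated (ind a).
  by apply: (@poly_dominated_le _ _ 1) => t; rewrite hornerC.
pose F a := E (ind a); pose G p a := E (fun t => p.[t] * ind a t).
have ind_nd a b t : a <= b -> ind a t <= ind b t.
  by move=> ab; rewrite /ind ler_nat; case: leP => // ta; rewrite (le_trans ta ab).
have Fnd : {homo F : a b / a <= b} by move=> a b ab; apply: Emono => // t; exact: ind_nd.
have Gnd p : (forall t, 0 <= p.[t]) -> {homo G p : a b / a <= b}.
  move=> p0 a b ab; apply: Emono; [exact: dmul|exact: dmul|] => t.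
  by rewrite ler_wpM2l// ind_nd.
have GC p a : (forall t, 0 <= p.[t]) -> 0 <= G p a <= moment_functional s p.
  move=> p0; have <- : E (horner (0 : {poly R})) = 0 by rewrite Epoly linear0.
  rewrite -Epoly; apply/andP; split; apply: Emono => //.
  - exact: poly_dominated_horner.
  - exact: dmul.
  - by move=> t; rewrite horner0 mulr_ge0//; have /andP[] := ind01 a t.
  - exact: dmul.
  - exact: poly_dominated_horner.
  - by move=> t; rewrite ler_piMr//; have /andP[] := ind01 a t.
have dens p : (forall t, 0 <= p.[t]) -> forall a b m, a <= b -> 0 <= m ->
    (forall t, a < t <= b -> m <= p.[t]) -> m * (F b - F a) <= G p b - G p a.
  move=> p0 a b m ab m0 mp.
  suff : m * F b + G p a <= G p b + m * F a by lra.
  rewrite -!EZ// -!ED//; do ?[exact: dmul|exact: poly_dominatedZ].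
  apply: Emono; do ?[apply: poly_dominatedD|exact: dmul|exact: poly_dominatedZ].
  move=> t; rewrite /ind; have [ta|ta] := leP t a.
    by rewrite (le_trans ta ab) addrC.
  have [tb|tb] := leP t b; last by rewrite !mulr0.
  by rewrite !mulr1 !mulr0 !addr0 mp// ta.
have [mu muE] := stieltjes_measure_exists Fnd; exists mu; split.
  move=> p p0; apply: (integral_poly_le Fnd (Gnd p p0) (dens p p0)) => // a.
  exact: GC.
(* the indicator of the complement of ]- c, c] is at most t^2 / c^2, so no mass
   escapes to infinity *)
apply/lee_addgt0Pr => e e0.
have s2 : 0 <= s 2%N by have := s_sqr 'X; rewrite moment_functionalXn.
pose c := s 2%N / e + 1.
have c1 : 1 <= c by rewrite lerDr divr_ge0// ltW.
have c0 : 0 < c by lra.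
have c2 : s 2%N / c ^+ 2 <= e.
  rewrite ler_pdivrMr ?exprn_gt0//; have : s 2%N / e <= c ^+ 2 by rewrite /c; nra.
  by rewrite ler_pdivrMr// mulrC.
have key : s 0%N + F (- c) <= F c + s 2%N / c ^+ 2.
  have -> : s 0%N = E (horner 1) by rewrite Epoly -polyC1 moment_functionalC mul1r.
  have -> : s 2%N / c ^+ 2 = E (horner (c ^- 2 *: 'X ^+ 2)).
    by rewrite Epoly linearZ/= moment_functionalXn mulrC.
  rewrite -!ED//; do ?exact: poly_dominated_horner.
  apply: Emono; do ?[apply: poly_dominatedD => //; exact: poly_dominated_horner].
  move=> t; rewrite hornerC hornerZ hornerXn mulrC.
  have out : c <= `|t| -> 1 <= t ^+ 2 / c ^+ 2.
    move=> ct; rewrite ler_pdivlMr ?exprn_gt0// mul1r -(real_normK (num_real t)).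
    by rewrite lerXn2r// nnegrE ltW.
  have pos : 0 <= t ^+ 2 / c ^+ 2 by rewrite divr_ge0// ?sqr_ge0// ltW.
  rewrite /ind; have [tc|tc] := leP t (- c).
    have tc' : t <= c by lra.
    by rewrite tc' lerD2l out// ler0_norm; lra.
  have [tc'|tc'] := leP t c; first by rewrite addr0 lerDl.
  by rewrite addr0 add0r out// gtr0_norm; lra.
apply: (@le_trans _ _ (mu `](- c - 1)%R, c]%classic + e%:E)%E); last first.
  by rewrite leeD2r// le_measure// inE.
rewrite muE; last by lra.
rewrite -EFinD lee_fin.
have h1 := right_lim_ge Fnd c.
have h2 : right_lim F (- c - 1) <= F (- c) by apply: right_lim_le => //; lra.
by lra.
Qed.

(** On polynomials bounded below the integral is at most the moment functional,
    the masses being equal; applied to [e X^(2n) + X^n] and [e X^(2n) - X^n] with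
    small [e] this gives equality on monomials. *)
Theorem hamburger s : (forall p, 0 <= moment_functional s (p ^+ 2)) ->
  exists mu, has_moments mu s.
Proof.
move=> s_sqr; have [mu [mu_le mu_ge]] := measure_poly_le_exists s_sqr.
exists mu.
have int p : mu.-integrable setT (EFin \o (horner p : RM -> R)).
  apply/integrableP; split; first by apply/measurable_EFinP; exact: measurable_horner.
  apply: le_lt_trans (ltry (moment_functional s (p ^+ 2 + 1))).
  apply: le_trans (mu_le _ _).
    apply: ge0_le_integral => //.
    - by apply: measurableT_comp => //; apply/measurable_EFinP; exact: measurable_horner.
    - by apply/measurable_EFinP; exact: measurable_horner.
    - move=> t _; rewrite lee_fin hornerD horner_exp hornerC.
      rewrite -(real_normK (num_real p.[t])); have := sqr_ge0 (`|p.[t]| - 1).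
      by have := normr_ge0 p.[t]; nra.
  by move=> t; rewrite hornerD horner_exp hornerC addr_ge0// sqr_ge0.
pose I p := \int[mu]_x p.[x].
have ID p q : I (p + q) = I p + I q.
  rewrite /I -RintegralD//.
  by apply: eq_Rintegral => x _; rewrite hornerD.
have IZ c p : I (c *: p) = c * I p.
  rewrite /I -RintegralZl//.
  by apply: eq_Rintegral => x _; rewrite hornerZ.
have IE p : (\int[mu]_x (p.[x])%:E = (I p)%:E)%E.
  by rewrite /I /Rintegral fineK// integrable_fin_num//; exact: int.
have I_ge0 p : (forall t, 0 <= p.[t]) -> 0 <= I p by move=> p0; exact: Rintegral_ge0.
have I_le0 p : (forall t, 0 <= p.[t]) -> I p <= moment_functional s p.
  by move=> p0; rewrite -lee_fin -IE; exact: mu_le.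
have I1 : s 0%N <= I 1.
  rewrite -lee_fin -IE; under eq_integral do rewrite hornerC.
  by rewrite integral_cst// mul1e.
have I_le c p : 0 <= c -> (forall t, - c <= p.[t]) -> I p <= moment_functional s p.
  move=> c0 pc; have := I_le0 (p + c *: 1).
  rewrite ID IZ linearD/= linearZ/= -polyC1 moment_functionalC mul1r polyC1 => h.
  have {}h : I p + c * I 1 <= moment_functional s p + c * s 0%N.
    by apply: h => t; rewrite hornerD hornerZ hornerC mulr1 -lerBlDr sub0r.
  have := ler_wpM2l c0 I1; lra.
move=> n; split.
  by apply: integrable_ext (int 'X^n) => x; rewrite hornerXn.
transitivity (I 'X^n)%:E; first by rewrite -IE; apply: eq_integral => x _; rewrite hornerXn.
congr EFin; set a := I _; pose b := s (n * 2)%N.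
have even t : ('X^(n * 2)).[t] = (t ^+ n) ^+ 2 :> R by rewrite hornerXn exprM.
have b0 : 0 <= I 'X^(n * 2) by apply: I_ge0 => t; rewrite even sqr_ge0.
have bnd e : 0 < e -> `|a - s n| <= e * b.
  move=> e0.
  have h (sg : R) : sg ^+ 2 = 1 -> e * I 'X^(n * 2) + sg * a <= e * b + sg * s n.
    move=> sg1; have := I_le (4 * e)^-1 (e *: 'X^(n * 2) + sg *: 'X^n).
    rewrite ID !IZ linearD/= !linearZ/= !moment_functionalXn; apply.
      by rewrite invr_ge0 mulr_ge0// ltW.
    move=> t; rewrite hornerD !hornerZ even hornerXn; set y := t ^+ n.
    have -> : e * y ^+ 2 + sg * y = e * (y + sg / (2 * e)) ^+ 2 - sg ^+ 2 * (4 * e)^-1.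
      by field; rewrite gt_eqF.
    by rewrite sg1 mul1r lerDr mulr_ge0 ?sqr_ge0// ltW.
  have h1 := h 1 (expr1n _ _); have h2 := h (-1) (sqrr_sign _ 1).
  have eI := mulr_ge0 (ltW e0) b0.
  by rewrite ler_norml; apply/andP; split; lra.
have bb : 0 <= b by have := bnd 1 ltr01; rewrite mul1r; exact: le_trans (normr_ge0 _).
apply/eqP; rewrite -subr_eq0 -normr_le0; apply/ler_addgt0Pl => e e0; rewrite addr0.
apply: le_trans (bnd (e / (b + 1)) _) _; first by rewrite divr_gt0// ltr_wpDl.
by rewrite mulrAC ler_pdivrMr ?ltr_wpDl// ler_pM2l// lerDl.
Qed.

End Hamburger.

(** * A gap forces indeterminacy *)

Section Indeterminacy.
Variable R : realType.
Local Notation RM := (measurableTypeR R).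
Implicit Types (s : nat -> R) (p q : {poly R}) (mu nu : {measure set RM -> \bar R}).

Lemma sum_sqr_coef_cons p (c : R) :
  sum_sqr_coef (p * 'X + c%:P) = c ^+ 2 + sum_sqr_coef p.
Proof.
rewrite (@sum_sqr_coef_widen _ _ (size p).+1); last first.
  rewrite (leq_trans (size_polyD _ _))// geq_max size_polyC.
  rewrite (leq_trans (size_polyMleq _ _)) ?size_polyX ?addn2//=.
  by case: (c != 0).
rewrite big_ord_recl coefD coefMX coefC eqxx/= add0r; congr +%R.
by apply: eq_bigr => i _; rewrite coefD coefMX coefC /= addr0.
Qed.

Lemma horner_sqr_le_sum_sqr_coef p (x : R) : `|x| <= 2^-1 ->
  p.[x] ^+ 2 <= 2 * sum_sqr_coef p.
Proof.
move=> x2; have {}x2 : x ^+ 2 <= 4^-1.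
  rewrite -(real_normK (num_real x)); have := normr_ge0 x; nra.
elim/poly_ind: p => [|p c IH].
  by rewrite horner0 /sum_sqr_coef size_poly0 big_ord0 expr0n mulr0.
rewrite sum_sqr_coef_cons !hornerE; have := sqr_ge0 (p.[x] * x - c).
have := sqr_ge0 x; have := sqr_ge0 p.[x]; nra.
Qed.

Lemma point_mass_integral (k : {nonneg R}) (x0 : R) (f : RM -> R) :
  measurable_fun setT f ->
  let m : {measure set RM -> \bar R} := mscale k (dirac (x0 : RM)) in
  m.-integrable setT (EFin \o f) /\ (\int[m]_x (f x)%:E = (k%:num * f x0)%:E)%E.
Proof.
move=> mf m; have mEf : measurable_fun setT (EFin \o f) by exact/measurable_EFinP.
have ge0 (g : RM -> \bar R) : measurable_fun setT g -> (forall x, 0 <= g x)%E ->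
    (\int[m]_x g x = k%:num%:E * g x0)%E.
  by move=> mg g0; rewrite ge0_integral_mscale// integral_dirac// diracT mul1e.
split.
  apply/integrableP; split=> //; rewrite ge0//; last exact: measurableT_comp.
  by rewrite -EFinM ltry.
rewrite integralE !ge0//; [|exact: measurable_funeneg|exact: measurable_funepos].
rewrite funeposE funenegE /=; have [h|/ltW h] := leP 0 (f x0).
- rewrite (max_idPl _) ?lee_fin// (max_idPr _); last by rewrite lee_fin oppr_le0.
  by rewrite mule0 sube0 EFinM.
- rewrite (max_idPr _) ?lee_fin// (max_idPl _); last by rewrite lee_fin oppr_ge0.
  by rewrite mule0 sub0e -EFinM mulrN -EFinN opprK.
Qed.

(** Subtracting a small multiple of evaluation at [x0] keeps the moment
    functional positive on squares, so the remainder has a representing measure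
    and adding the mass at [x0] back gives the moments [s]. *)
Lemma gap_point_mass s (c x0 : R) : 0 < c ->
  (forall p, c * sum_sqr_coef p <= moment_functional s (p ^+ 2)) -> `|x0| <= 2^-1 ->
  exists2 mu, has_moments mu s & ((c / 2)%:E <= mu [set x0])%E.
Proof.
move=> c0 gap x02; pose s' n := s n - c / 2 * x0 ^+ n.
have s'E p : moment_functional s' p = moment_functional s p - c / 2 * p.[x0].
  rewrite horner_coef mulr_sumr -sumrB; apply: eq_bigr => i _.
  by rewrite /s'; ring.
have [nu nus'] : exists nu, has_moments nu s'.
  apply: hamburger => p; rewrite s'E horner_exp subr_ge0; apply: le_trans (gap p).
  by have := horner_sqr_le_sum_sqr_coef p x02; have := c0; nra.
have k0 : 0 <= c / 2 by lra.
pose m : {measure set RM -> \bar R} := mscale (NngNum k0) (dirac (x0 : RM)).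
exists (measure_add nu m).
  move=> n; have [i1 e1] := nus' n.
  have mX : measurable_fun setT (fun x : RM => x ^+ n) by exact: measurable_funX.
  have [i2 e2] := point_mass_integral (NngNum k0) x0 mX.
  have e : (\int[measure_add nu m]_x ((x : R) ^+ n)%:E = (s n)%:E)%E.
    rewrite integral_measure_add// e1 [X in (_ + X)%E]e2 -EFinD /s' /=.
    by congr EFin; ring.
  split=> //; apply/integrableP; split; first exact/measurable_EFinP.
  rewrite ge0_integral_measure_add//; last first.
    by apply: measurableT_comp => //; exact/measurable_EFinP.
  have /integrableP[_ h1] := i1; have /integrableP[_ h2] := i2.
  exact: lte_add_pinfty.
have addE : measure_add nu m [set x0] = (nu [set x0] + m [set x0])%E := measure_addE _ _ _.
apply: (@le_trans _ _ (m [set x0])); last by rewrite [leRHS]addE leeDr.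
by rewrite /m/= /mscale/= diracE mem_set//= mule1.
Qed.

(** Under determinacy every point of an interval would carry at least a fixed
    mass, but the total mass is finite. *)
Lemma gap_not_determinate alpha s (c : R) : 0 < c ->
  (forall p, c * sum_sqr_coef p <= moment_functional s (p ^+ 2)) ->
  ~ determinate alpha s.
Proof.
move=> c0 gap [alpha_s uniq].
pose x n : R := n.+2%:R^-1.
have x2 n : `|x n| <= 2^-1.
  by rewrite ger0_norm ?invr_ge0// lef_pV2 ?posrE// ler_nat.
have mass n : ((c / 2)%:E <= alpha [set x n])%E.
  have [mu mus h] := gap_point_mass c0 gap (x2 n).
  by rewrite -(uniq mu mus)//; exact: measurable_set1.
have xI n m : x n = x m -> n = m.
  by move=> /invr_inj/eqP; rewrite eqr_nat => /eqP[].
have fin : (alpha setT < +oo)%E.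
  have [/integrableP[_]] := alpha_s 0%N.
  by under eq_integral do rewrite expr0 abse1; rewrite integral_cst// mul1e.
have lower n : ((n%:R * (c / 2))%:E <= alpha setT)%E.
  apply: (@le_trans _ _ (alpha (\big[setU/set0]_(i < n) [set x i]))); last first.
    rewrite le_measure ?inE//; apply: bigsetU_measurable => i _; exact: measurable_set1.
  rewrite (@measure_semi_additive_ord_I _ _ _ alpha (fun i => [set x i])).
  - elim: n => [|n IH]; first by rewrite mul0r big_ord0.
    by rewrite big_ord_recr/= -natr1 mulrDl mul1r EFinD leeD.
  - by move=> k _; exact: measurable_set1.
  - by move=> i j _ _ [y [/= yi yj]]; apply: xI; rewrite -yi -yj.
  - by apply: bigsetU_measurable => i _; exact: measurable_set1.
have [M MC] : exists M : R, alpha setT = M%:E.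
  by exists (fine (alpha setT)); rewrite fineK// ge0_fin_numE.
pose n := (Num.truncn (M / (c / 2))).+1.
have := lower n; rewrite MC lee_fin leNgt => /negP; apply.
by rewrite -ltr_pdivrMr ?divr_gt0// truncnS_gt.
Qed.

End Indeterminacy.

Theorem theorem1p1 (R : realType)
    (alpha : {measure set (measurableTypeR R) -> \bar R}) (s : nat -> R)
    (alpha_s : has_moments alpha s)
    (alpha_inf : infinite_set (measure_support alpha)) :
  determinate alpha s <->
  smallest_eigenvalue (hankel s N) @[N --> \oo] --> (0 : R).
Proof.
rewrite cvg_smallest_eigenvalue_hankel; last first.
  by move=> p; exact: moment_functional_sqr_ge0 alpha_s.
split=> [det [c c0 gap]|nogap].
  exact: gap_not_determinate c0 gap det.
split=> // nu nus A mA; apply: (measure_eq_no_gap nus alpha_s) => // c c0.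
apply: contrapT => /forallNP h; apply: nogap; exists c => // p.
by rewrite leNgt; apply/negP/h.
Qed.
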